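(* Let $(A,\varphi,\phi_A,[\cdot,\cdot]_A,a_A)$ be a Hom-Lie algebroid over $M$ whose underlying Hom-bundle is invertible, and let $\mathrm{d}:\Gamma(\wedge^kA^* )\to\Gamma(\wedge^{k+1}A^* )$ be its differential operator. Then $\mathrm{d}^2=0$. Furthermore, for all $\Xi\in\Gamma(\wedge^kA^* )$ and $\Theta\in\Gamma(\wedge^lA^* )$, $$\mathrm{d}\circ\phi_A^\dagger=\phi_A^\dagger\circ\mathrm{d},\qquad \mathrm{d}(\Xi\wedge\Theta)=\mathrm{d}\Xi\wedge\phi_A^\dagger(\Theta)+(-1)^k\phi_A^\dagger(\Xi)\wedge\mathrm{d}\Theta.$$ Therefore $(\oplus_k\Gamma(\wedge^kA^* ),\wedge,\phi_A^\dagger,\mathrm{d})$ is a $(\phi_A^\dagger,\phi_A^\dagger)$-differential graded commutative algebra.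
   Context: Manifolds, bundles and maps are smooth; functions are real-valued. A Hom-Lie algebra $(\mathfrak g,[\cdot,\cdot],\phi)$ is a vector space with a skew-symmetric bilinear bracket and a linear map $\phi$ such that $\phi[x,y]=[\phi(x),\phi(y)]$ and $[\phi(x),[y,z]]+[\phi(y),[z,x]]+[\phi(z),[x,y]]=0$. A representation of it on a vector space $V$ with respect to $\beta\in\mathfrak{gl}(V)$ is a linear map $\rho:\mathfrak g\to\mathfrak{gl}(V)$ with $\rho(\phi(x))\circ\beta=\beta\circ\rho(x)$ and $\rho([x,y])\circ\beta=\rho(\phi(x))\circ\rho(y)-\rho(\phi(y))\circ\rho(x)$. For $\varphi:M\to M$, $\varphi^*f=f\circ\varphi$. A Hom-bundle $(A\to M,\varphi,\phi_A)$ is a vector bundle $A\to M$ with a smooth map $\varphi:M\to M$ and a linear map $\phi_A:\Gamma(A)\to\Gamma(A)$ such that $\phi_A(fx)=\varphi^*(f)\phi_A(x)$; it is invertible if $\varphi$ is a diffeomorphism and $\phi_A$ is invertible. $\phi_A$ is extended to $\Gamma(\wedge^kA)$ by $\phi_A(x_1\wedge\cdots\wedge x_k)=\phi_A(x_1)\wedge\cdots\wedge\phi_A(x_k)$ and to functions by $\varphi^*$. For an invertible Hom-bundle define $\phi_A^\dagger:\Gamma(\wedge^kA^* )\to\Gamma(\wedge^kA^* )$ by $(\phi_A^\dagger(\Xi))(X)=\varphi^*\big(\Xi(\phi_A^{-1}(X))\big)$ (so $\phi_A^\dagger=\varphi^*$ on functions). $\varphi^!TM$ is the pullback bundle of $TM$;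 a section $x$ acts on functions by $x(f)(m)=x_m(f)$, where $x_m\in T_{\varphi(m)}M$, so $x(fg)=x(f)\varphi^*(g)+\varphi^*(f)x(g)$. A Hom-Lie algebroid $(A,\varphi,\phi_A,[\cdot,\cdot]_A,a_A)$ is a Hom-bundle $(A\to M,\varphi,\phi_A)$ with a Hom-Lie algebra structure $(\Gamma(A),[\cdot,\cdot]_A,\phi_A)$ and a bundle map $a_A:A\to\varphi^!TM$ (anchor) such that (i) $[x,fy]_A=\varphi^*(f)[x,y]_A+a_A(\phi_A(x))(f)\,\phi_A(y)$ for $x,y\in\Gamma(A)$, $f\in C^\infty(M)$; (ii) $a_A$ is a representation of $(\Gamma(A),[\cdot,\cdot]_A,\phi_A)$ on $C^\infty(M)$ with respect to $\varphi^*$. The differential operator is $$(\mathrm{d}\Xi)(x_1,\dots,x_{k+1})=\sum_{i=1}^{k+1}(-1)^{i+1}a_A(x_i)\Xi\big(\phi_A^{-1}(x_1),\dots,\widehat{\phi_A^{-1}(x_i)},\dots,\phi_A^{-1}(x_{k+1})\big)+\sum_{i<j}(-1)^{i+j}\phi_A^\dagger(\Xi)\big([\phi_A^{-1}(x_i),\phi_A^{-1}(x_j)]_A,x_1,\dots,\widehat{x_i},\dots,\widehat{x_j},\dots,x_{k+1}\big).$$ A $(\sigma,\tau)$-differential graded commutative algebra is a graded commutative algebra $\mathfrak A=\oplus_k\mathfrak A_k$ with degree $0$ algebra endomorphisms $\sigma,\tau$ and a degree $1$ operator $d$ such that $d^2=0$, $d\sigma=\sigma d$, $d\tau=\tau d$,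 and $d(ab)=d(a)\tau(b)+(-1)^k\sigma(a)d(b)$ for $a\in\mathfrak A_k$, $b\in\mathfrak A_l$. *)

(* Defs.v *)
From HB Require Import structures.
From mathcomp Require Import all_boot all_order all_algebra all_fingroup.
From mathcomp Require Import boolp classical_sets functions reals topology.
From mathcomp Require Import normedtype landau derive.
Set Implicit Arguments.
Unset Strict Implicit.
Unset Printing Implicit Defensive.
Import Order.TTheory GRing.Theory Num.Theory.
Import numFieldNormedType.Exports.
Local Open Scope classical_set_scope.
Local Open Scope ring_scope.

Section SmoothEuclidean.
Variable R : realType.

(* [Ck k f x]: f is k times (Frechet) differentiable around x, and its k-th
   iterated directional derivatives are continuous at x.  At every point of an
   open set and for every k, this says that f is C^oo on that open set. *)
Fixpoint Ck n (k : nat) (f : 'rV[R]_n -> R) (x : 'rV[R]_n) : Prop :=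
  if k is k'.+1 then
    (\forall y \near x, differentiable f y) /\
    (forall v : 'rV[R]_n, Ck k' (fun y => 'D_v f y) x)
  else {for x, continuous f}.

Definition smooth_at n (f : 'rV[R]_n -> R) (x : 'rV[R]_n) : Prop :=
  forall k, Ck k f x.

Let near_rV n (x : 'rV[R]_n) (P : set 'rV[R]_n) :
  (forall y, P y) -> \forall y \near x, P y.
Proof. by move=> HP; exact: (@nearW _ (nbhs x)). Qed.

Lemma near_eq_differentiable n (f g : 'rV[R]_n -> R) x :
  (\forall y \near x, f y = g y) -> differentiable f x -> differentiable g x.
Proof.
move=> fg df; have fgx := nbhs_singleton fg.
have [cdf /eqaddoP ef] := (diff_locallyP _ _).1 df.
have e : g \o shift x = cst (g x) + 'd f x +o_ 0 id.
  apply/eqaddoP => eps eps0; have := ef _ eps0.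
  move: (fg); rewrite (near_shift 0) => fg0.
  apply: filterS2 fg0 => y /=; rewrite subr0 => fgy.
  by rewrite !fctE /= fgx fgy.
by apply/diff_locallyP; rewrite (diff_unique cdf e).
Qed.

Lemma Ck_ext n k (f g : 'rV[R]_n -> R) x :
  (\forall y \near x, f y = g y) -> Ck k f x -> Ck k g x.
Proof.
elim: k f g => [|k IH] f g fg /=.
  move=> cf; suff: g @ x --> f x by rewrite (nbhs_singleton fg).
  apply: cvg_trans (cf : f @ x --> f x).
  exact: (near_eq_cvg fg).
have fg2 := near_join fg.
case=> df Df; split.
  by apply: filterS2 fg2 df => y; exact: near_eq_differentiable.
move=> v; apply: IH (Df v); apply: filterS fg2 => y.
exact: near_eq_derive.
Qed.

Lemma CkS n k (f : 'rV[R]_n -> R) x : Ck k.+1 f x -> Ck k f x.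
Proof.
elim: k f => [|k IH] f [df Df].
  exact: (differentiable_continuous (nbhs_singleton df)).
by split => // v; apply: IH.
Qed.

Lemma Ck_cst n k (a : R) (x : 'rV[R]_n) : Ck k (fun=> a) x.
Proof.
elim: k a => [|k IH] a /=; first exact: cst_continuous.
split; first by apply: near_rV => y; exact: differentiable_cst.
by move=> v; apply: Ck_ext (IH 0); apply: near_rV => y; rewrite derive_cst.
Qed.

Lemma CkD n k (f g : 'rV[R]_n -> R) x :
  Ck k f x -> Ck k g x -> Ck k (fun y => f y + g y) x.
Proof.
elim: k f g => [|k IH] f g /=; first exact: continuousD.
move=> [df Df] [dg Dg]; split.
  by apply: filterS2 df dg => y; exact: differentiableD.
move=> v; apply: Ck_ext (IH _ _ (Df v) (Dg v)).
by apply: filterS2 df dg => y dfy dgy; rewrite deriveD //; exact: diff_derivable.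
Qed.

Lemma CkM n k (f g : 'rV[R]_n -> R) x :
  Ck k f x -> Ck k g x -> Ck k (fun y => f y * g y) x.
Proof.
elim: k f g => [|k IH] f g; first exact: continuousM.
move=> Cf Cg; have [df Df] := Cf; have [dg Dg] := Cg; split.
  by apply: filterS2 df dg => y; exact: differentiableM.
move=> v.
apply: Ck_ext (CkD (IH _ _ (CkS Cf) (Dg v)) (IH _ _ (CkS Cg) (Df v))).
by apply: filterS2 df dg => y dfy dgy; rewrite deriveM //; exact: diff_derivable.
Qed.

Lemma Ck_sum n k (I : Type) (s : seq I) (P : pred I)
    (f : I -> 'rV[R]_n -> R) x :
  (forall i, P i -> Ck k (f i) x) -> Ck k (fun y => \sum_(i <- s | P i) f i y) x.
Proof.
move=> Cf; elim: s => [|i s IH].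
  by apply: Ck_ext (Ck_cst k 0 x); apply: near_rV => y; rewrite big_nil.
case Pi: (P i).
  apply: Ck_ext (CkD (Cf _ Pi) IH).
  by apply: near_rV => y; rewrite big_cons Pi.
by apply: Ck_ext IH; apply: near_rV => y; rewrite big_cons Pi.
Qed.

Lemma rV_continuous n p (g : 'rV[R]_n -> 'rV[R]_p) x :
  (forall i, {for x, continuous (fun y => g y 0 i)}) -> {for x, continuous g}.
Proof.
move=> cg A [P HP sPA].
suff: \forall y \near x, forall i, P 0 i (g y 0 i).
  by apply: filterS => y Py; apply: sPA => i j; rewrite !ord1.
apply: (@filter_forall _ _ _ (nbhs x)) => i; apply: (cg i); exact: HP.
Qed.

Lemma rV_differentiable n p (g : 'rV[R]_n -> 'rV[R]_p) x :
  (forall i, differentiable (fun y => g y 0 i) x) -> differentiable g x.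
Proof.
move=> dg.
have -> : g = \sum_(i < p) (fun y => g y 0 i *: (delta_mx 0 i : 'rV[R]_p)).
  by apply/funext => y; rewrite fct_sumE; exact: row_sum_delta.
by apply: differentiable_sum => i; exact: differentiableZl.
Qed.

Lemma derive_coord n p (g : 'rV[R]_n -> 'rV[R]_p) x v i :
  differentiable g x -> ('D_v g x) 0 i = 'D_v (fun y => g y 0 i) x.
Proof.
move=> dg.
have dc := differentiable_coord (g x) 0 i.
have dgi : differentiable (fun y => g y 0 i) x.
  exact: (differentiable_comp dg dc).
rewrite !deriveE //.
pose c := fun N : 'rV[R]_p => N 0 i.
have -> : 'd (fun y => g y 0 i) x = 'd c (g x) \o 'd g x :> (_ -> _).
  exact: (diff_comp dg dc).
have c_lin : linear c by move=> a u w; rewrite /c !mxE.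
pose cM := GRing.isLinear.Build _ _ _ _ c c_lin.
pose cL : {linear 'rV[R]_p -> R} := HB.pack c cM.
have dcE : 'd c (g x) = c :> (_ -> _).
  by apply: (@diff_lin _ _ _ cL); exact: coord_continuous.
by rewrite dcE.
Qed.

Lemma derive_sum_coord n (f : 'rV[R]_n -> R) x (v : 'rV[R]_n) :
  differentiable f x ->
  'D_v f x = \sum_(i < n) v 0 i * 'D_(delta_mx 0 i) f x.
Proof.
move=> df; rewrite deriveE // {1}(row_sum_delta v) linear_sum.
by apply: eq_bigr => i _; rewrite linearZ deriveE.
Qed.

Lemma Ck_comp n p k (f : 'rV[R]_p -> R) (g : 'rV[R]_n -> 'rV[R]_p) x :
  (forall i, Ck k (fun y => g y 0 i) x) -> Ck k f (g x) ->
  Ck k (fun y => f (g y)) x.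
Proof.
elim: k f => [|k IH] f Cg Cf.
  by apply: (@continuous_comp _ _ _ g f) => //; exact: rV_continuous.
have dg : \forall y \near x, differentiable g y.
  have : \forall y \near x, forall i, differentiable (fun z => g z 0 i) y.
    by apply: (@filter_forall _ _ _ (nbhs x)) => i; case: (Cg i).
  by apply: filterS => y; exact: rV_differentiable.
have [df Df] := Cf.
have df' : \forall y \near x, differentiable f (g y).
  exact: (differentiable_continuous (nbhs_singleton dg)) df.
split.
  by apply: filterS2 dg df' => y; exact: differentiable_comp.
move=> v.
apply: (@Ck_ext _ _ (fun y => \sum_(i < p)
    'D_v (fun z => g z 0 i) y * 'D_(delta_mx 0 i) f (g y))).
  apply: filterS2 dg df' => y dgy dfy.
  rewrite deriveE; last exact: (differentiable_comp dgy dfy).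
  rewrite (_ : 'd (fun y => f (g y)) y v = 'd f (g y) ('d g y v)); last first.
    by rewrite (diff_comp dgy dfy).
  rewrite -!deriveE // derive_sum_coord //.
  by apply: eq_bigr => i _; rewrite derive_coord.
apply: Ck_sum => i _; apply: CkM; first exact: ((Cg i).2 v).
exact: (IH (fun z => 'D_(delta_mx 0 i) f z) (fun j => CkS (Cg j)) (Df _)).
Qed.

End SmoothEuclidean.

Record chart (R : realType) (n : nat) (T : topologicalType) := Chart {
  cdom : set T;
  cmap : T -> 'rV[R]_n;
  cinv : 'rV[R]_n -> T;
  cdom_open : open cdom;
  cimg_open : open (cmap @` cdom);
  cmapK : forall p, cdom p -> cinv (cmap p) = p;
  cmap_continuous : forall p, cdom p -> {for p, continuous cmap};
  cinv_continuous : forall p, cdom p -> {for cmap p, continuous cinv}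
}.

Record manifold (R : realType) (n : nat) := Manifold {
  mspace :> topologicalType;
  atlas : set (chart R n mspace);
  manifold_hausdorff : hausdorff_space mspace;
  manifold_second_countable : @second_countable mspace;
  atlas_cover : forall p, exists2 c, atlas c & cdom c p;
  atlas_compat : forall c c' p i, atlas c -> atlas c' ->
    cdom c p -> cdom c' p ->
    smooth_at (fun u => cmap c' (cinv c u) 0 i) (cmap c p)
}.

Section SmoothFunctions.
Variables (R : realType) (n : nat) (M : manifold R n).

Definition smooth_fun_at (f : M -> R) (p : M) : Prop :=
  forall c : chart R n M, atlas c -> cdom c p -> smooth_at (f \o cinv c) (cmap c p).

Lemma cinv_near (c : chart R n M) (p : M) (P : set M) : cdom c p ->
  (\forall q \near p, P q) -> \forall u \near cmap c p, P (cinv c u).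
Proof.
move=> cp HP; apply: (cinv_continuous cp).
by rewrite (cmapK cp); exact: HP.
Qed.

Lemma smooth_fun_ext (f g : M -> R) p :
  (\forall q \near p, f q = g q) -> smooth_fun_at f p -> smooth_fun_at g p.
Proof.
by move=> fg sf c ac cp k; apply: Ck_ext (sf c ac cp k); exact: (cinv_near (P := fun q => f q = g q)) fg.
Qed.

Lemma smooth_cst a p : smooth_fun_at (fun=> a) p.
Proof. by move=> c ac cp k; exact: Ck_cst. Qed.

Lemma smoothD (f g : M -> R) p : smooth_fun_at f p -> smooth_fun_at g p ->
  smooth_fun_at (fun q => f q + g q) p.
Proof. by move=> sf sg c ac cp k; apply: CkD; [exact: sf|exact: sg]. Qed.

Lemma smoothM (f g : M -> R) p : smooth_fun_at f p -> smooth_fun_at g p ->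
  smooth_fun_at (fun q => f q * g q) p.
Proof. by move=> sf sg c ac cp k; apply: CkM; [exact: sf|exact: sg]. Qed.

Lemma smoothN (f : M -> R) p :
  smooth_fun_at f p -> smooth_fun_at (fun q => - f q) p.
Proof.
move=> sf; apply: (@smooth_fun_ext (fun q => -1 * f q)).
  by apply: nearW => q; rewrite mulN1r.
by apply: smoothM => //; exact: smooth_cst.
Qed.

Lemma smooth_sum (I : Type) (s : seq I) (P : pred I) (f : I -> M -> R) p :
  (forall i, P i -> smooth_fun_at (f i) p) ->
  smooth_fun_at (fun q => \sum_(i <- s | P i) f i q) p.
Proof.
by move=> sf c ac cp k; apply: Ck_sum => i Pi; exact: (sf i Pi c ac cp k).
Qed.

Lemma smooth_prod (I : Type) (s : seq I) (f : I -> M -> R) p :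
  (forall i, smooth_fun_at (f i) p) ->
  smooth_fun_at (fun q => \prod_(i <- s) f i q) p.
Proof.
move=> sf; elim: s => [|i s IH].
  apply: (@smooth_fun_ext (fun=> 1)); last exact: smooth_cst.
  by apply: nearW => q; rewrite big_nil.
apply: (@smooth_fun_ext (fun q => f i q * \prod_(j <- s) f j q)).
  by apply: nearW => q; rewrite big_cons.
exact: smoothM.
Qed.

Record smooth_fun := SmoothFun {
  sfun :> M -> R;
  sfun_smooth : forall p, smooth_fun_at sfun p
}.

Arguments sfun_smooth : clear implicits.

Lemma smooth_fun_eq (f g : smooth_fun) : (forall p, f p = g p) -> f = g.
Proof.
case: f g => [f sf] [g sg] /= fg.
have e : f = g by exact: funext.
by subst g; congr SmoothFun; exact: Prop_irrelevance.
Qed.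

HB.instance Definition _ := gen_eqMixin smooth_fun.
HB.instance Definition _ := gen_choiceMixin smooth_fun.

Definition sf_cst (a : R) := SmoothFun (smooth_cst a).
Definition sf_add (f g : smooth_fun) :=
  SmoothFun (fun p => smoothD (sfun_smooth f p) (sfun_smooth g p)).
Definition sf_opp (f : smooth_fun) :=
  SmoothFun (fun p => smoothN (sfun_smooth f p)).
Definition sf_mul (f g : smooth_fun) :=
  SmoothFun (fun p => smoothM (sfun_smooth f p) (sfun_smooth g p)).
Definition sf_scale (a : R) (f : smooth_fun) := sf_mul (sf_cst a) f.

Let sf_addA : associative sf_add.
Proof. by move=> f g h; apply: smooth_fun_eq => p /=; rewrite addrA. Qed.
Let sf_addC : commutative sf_add.
Proof. by move=> f g; apply: smooth_fun_eq => p /=; rewrite addrC. Qed.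
Let sf_add0 : left_id (sf_cst 0) sf_add.
Proof. by move=> f; apply: smooth_fun_eq => p /=; rewrite add0r. Qed.
Let sf_addN : left_inverse (sf_cst 0) sf_opp sf_add.
Proof. by move=> f; apply: smooth_fun_eq => p /=; rewrite addNr. Qed.

HB.instance Definition _ :=
  GRing.isZmodule.Build smooth_fun sf_addA sf_addC sf_add0 sf_addN.

Let sf_mulA : associative sf_mul.
Proof. by move=> f g h; apply: smooth_fun_eq => p /=; rewrite mulrA. Qed.
Let sf_mulC : commutative sf_mul.
Proof. by move=> f g; apply: smooth_fun_eq => p /=; rewrite mulrC. Qed.
Let sf_mul1 : left_id (sf_cst 1) sf_mul.
Proof. by move=> f; apply: smooth_fun_eq => p /=; rewrite mul1r. Qed.
Let sf_mulD : left_distributive sf_mul +%R.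
Proof. by move=> f g h; apply: smooth_fun_eq => p /=; rewrite mulrDl. Qed.

HB.instance Definition _ := GRing.Zmodule_isComPzRing.Build smooth_fun
  sf_mulA sf_mulC sf_mul1 sf_mulD.

Let sf_scaleA a b f : sf_scale a (sf_scale b f) = sf_scale (a * b) f.
Proof. by apply: smooth_fun_eq => p /=; rewrite mulrA. Qed.
Let sf_scale1 : left_id 1 sf_scale.
Proof. by move=> f; apply: smooth_fun_eq => p /=; rewrite mul1r. Qed.
Let sf_scaleDr : right_distributive sf_scale +%R.
Proof. by move=> a f g; apply: smooth_fun_eq => p /=; rewrite mulrDr. Qed.
Let sf_scaleDl f : {morph sf_scale^~ f : a b / a + b}.
Proof. by move=> a b; apply: smooth_fun_eq => p /=; rewrite mulrDl. Qed.

HB.instance Definition _ := GRing.Zmodule_isLmodule.Build R smooth_fun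
  sf_scaleA sf_scale1 sf_scaleDr sf_scaleDl.

(* Tangent vectors are derivations of C^oo(M) at p. *)
Record tangent (p : M) := Tangent {
  tval :> smooth_fun -> R;
  tval_linear : forall (a : R) f g, tval (a *: f + g) = a * tval f + tval g;
  tval_leibniz : forall f g : smooth_fun,
    tval (f * g) = tval f * g p + f p * tval g
}.

Section TangentModule.
Variable p : M.
Implicit Types v w : tangent p.

Lemma tangent_eq v w : (forall f, v f = w f) -> v = w.
Proof.
case: v w => [v v1 v2] [w w1 w2] /= vw.
have e : v = w by exact: funext.
by subst w; congr Tangent; exact: Prop_irrelevance.
Qed.

HB.instance Definition _ := gen_eqMixin (tangent p).
HB.instance Definition _ := gen_choiceMixin (tangent p).

Let tan_lin0 (a : R) (f g : smooth_fun) : (0 : R) = a * 0 + 0.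
Proof. by rewrite mulr0 addr0. Qed.
Let tan_leib0 (f g : smooth_fun) : (0 : R) = 0 * g p + f p * 0.
Proof. by rewrite mulr0 mul0r addr0. Qed.
Definition tan_zero := @Tangent p (fun=> 0) tan_lin0 tan_leib0.

Let tan_linD v w (a : R) (f g : smooth_fun) :
  v (a *: f + g) + w (a *: f + g) = a * (v f + w f) + (v g + w g).
Proof. by rewrite !tval_linear mulrDr addrACA. Qed.
Let tan_leibD v w (f g : smooth_fun) :
  v (f * g) + w (f * g) = (v f + w f) * g p + f p * (v g + w g).
Proof. by rewrite !tval_leibniz mulrDr mulrDl addrACA. Qed.
Definition tan_add v w :=
  @Tangent p (fun f => v f + w f) (tan_linD v w) (tan_leibD v w).

Let tan_linZ b v (a : R) (f g : smooth_fun) :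
  b * v (a *: f + g) = a * (b * v f) + b * v g.
Proof. by rewrite tval_linear mulrDr mulrCA. Qed.
Let tan_leibZ b v (f g : smooth_fun) :
  b * v (f * g) = b * v f * g p + f p * (b * v g).
Proof. by rewrite tval_leibniz mulrDr mulrA [f p * (b * _)]mulrCA. Qed.
Definition tan_scale b v :=
  @Tangent p (fun f => b * v f) (tan_linZ b v) (tan_leibZ b v).

Let tan_addA : associative tan_add.
Proof. by move=> u v w; apply: tangent_eq => f /=; rewrite addrA. Qed.
Let tan_addC : commutative tan_add.
Proof. by move=> u v; apply: tangent_eq => f /=; rewrite addrC. Qed.
Let tan_add0 : left_id tan_zero tan_add.
Proof. by move=> u; apply: tangent_eq => f /=; rewrite add0r. Qed.
Let tan_addN : left_inverse tan_zero (tan_scale (-1)) tan_add.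
Proof. by move=> u; apply: tangent_eq => f /=; rewrite mulN1r addNr. Qed.

HB.instance Definition _ :=
  GRing.isZmodule.Build (tangent p) tan_addA tan_addC tan_add0 tan_addN.

Let tan_scaleA a b v : tan_scale a (tan_scale b v) = tan_scale (a * b) v.
Proof. by apply: tangent_eq => f /=; rewrite mulrA. Qed.
Let tan_scale1 : left_id 1 tan_scale.
Proof. by move=> v; apply: tangent_eq => f /=; rewrite mul1r. Qed.
Let tan_scaleDr : right_distributive tan_scale +%R.
Proof. by move=> a v w; apply: tangent_eq => f /=; rewrite mulrDr. Qed.
Let tan_scaleDl v : {morph tan_scale^~ v : a b / a + b}.
Proof. by move=> a b; apply: tangent_eq => f /=; rewrite mulrDl. Qed.

HB.instance Definition _ := GRing.Zmodule_isLmodule.Build R (tangent p)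
  tan_scaleA tan_scale1 tan_scaleDr tan_scaleDl.

(* In the chart c around p, v = \sum_i (w 0 i) * d/dx_i. *)
Definition tangent_coord (c : chart R n M) v (w : 'rV[R]_n) : Prop :=
  forall f : smooth_fun, v f = 'D_w (f \o cinv c) (cmap c p).

End TangentModule.

Record smooth_map := SmoothMap {
  smap :> M -> M;
  smap_continuous : continuous smap;
  smap_smooth : forall (c c' : chart R n M) p i, atlas c -> atlas c' ->
    cdom c p -> cdom c' (smap p) ->
    smooth_at (fun u => cmap c' (smap (cinv c u)) 0 i) (cmap c p)
}.

Lemma smooth_chart_comp (phi : smooth_map) (c : chart R n M) (h : 'rV[R]_n -> R) p :
  atlas c -> cdom c (phi p) -> smooth_at h (cmap c (phi p)) ->
  smooth_fun_at (fun q => h (cmap c (phi q))) p.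
Proof.
move=> ac cp sh c0 ac0 c0p k.
apply: (@Ck_comp R n n k h (fun u => cmap c (phi (cinv c0 u)))).
  by move=> i; exact: smap_smooth.
by rewrite (cmapK c0p); exact: sh.
Qed.

Lemma pullback_smooth (phi : smooth_map) (f : smooth_fun) p :
  smooth_fun_at (f \o phi) p.
Proof.
have [c ac cp] := atlas_cover (phi p).
apply: smooth_fun_ext (smooth_chart_comp ac cp (sfun_smooth f _ c ac cp)).
have cn : nbhs (phi p) (cdom c).
  by apply: open_nbhs_nbhs; split => //; exact: cdom_open.
have phicn : nbhs p (phi @^-1` cdom c) by exact: (@smap_continuous phi p _ cn).
by apply: filterS phicn => q cq /=; rewrite (cmapK cq).
Qed.

Definition pullback (phi : smooth_map) (f : smooth_fun) : smooth_fun :=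
  SmoothFun (pullback_smooth phi f).

End SmoothFunctions.

Record triv (R : realType) (r : nat) (T : topologicalType)
    (E : T -> lmodType R) := Triv {
  tdom : set T;
  tfun : forall p, {linear E p -> 'rV[R]_r};
  tinv : forall p, 'rV[R]_r -> E p;
  tdom_open : open tdom;
  tfunK : forall p, tdom p -> cancel (tfun p) (@tinv p);
  tinvK : forall p, tdom p -> cancel (@tinv p) (tfun p)
}.

(* The total space of the bundle carries the topology and the smooth structure
   for which the local trivialisations are diffeomorphisms. *)
Record vbundle (R : realType) (n : nat) (M : manifold R n) (r : nat) :=
  VBundle {
  fib :> M -> lmodType R;
  batlas : set (triv r fib);
  batlas_cover : forall p, exists2 t, batlas t & tdom t p;
  batlas_compat : forall (t t' : triv r fib) p i j, batlas t -> batlas t' ->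
    tdom t p -> tdom t' p ->
    smooth_fun_at (fun q => tfun t' q (tinv t q (delta_mx 0 j)) 0 i) p
}.

Section Bundle.
Variables (R : realType) (n : nat) (M : manifold R n) (r : nat).
Variable A : vbundle M r.

Definition frame (t : triv r A) (j : 'I_r) (p : M) : A p :=
  tinv t p (delta_mx 0 j).

Lemma frame_decomp (t : triv r A) p (v : A p) : tdom t p ->
  v = \sum_(j < r) tfun t p v 0 j *: frame t j p.
Proof.
move=> tp; apply: (can_inj (tfunK tp)).
rewrite linear_sum {1}(row_sum_delta (tfun t p v)).
by apply: eq_bigr => j _; rewrite linearZ /= /frame (tinvK tp).
Qed.

Definition smooth_sect_at (x : forall p, A p) (p : M) : Prop :=
  forall t i, batlas t -> tdom t p ->
  smooth_fun_at (fun q => tfun t q (x q) 0 i) p.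

Record sect := Sect {
  sect_val :> forall p, A p;
  sect_smooth : forall p, smooth_sect_at sect_val p
}.

Lemma sect_eq (x y : sect) : (forall p, x p = y p) -> x = y.
Proof.
case: x y => [x sx] [y sy] /= xy.
have e : x = y by exact: functional_extensionality_dep.
by subst y; congr Sect; exact: Prop_irrelevance.
Qed.

HB.instance Definition _ := gen_eqMixin sect.
HB.instance Definition _ := gen_choiceMixin sect.

Let zero_smooth p : smooth_sect_at (fun q => 0 : A q) p.
Proof.
move=> t i bt tp; apply: (@smooth_fun_ext _ _ _ (fun=> 0)).
  by apply: nearW => q; rewrite linear0 mxE.
exact: smooth_cst.
Qed.
Let add_smooth (x y : sect) p : smooth_sect_at (fun q => x q + y q) p.
Proof.
move=> t i bt tp.
apply: (@smooth_fun_ext _ _ _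
  (fun q => tfun t q (x q) 0 i + tfun t q (y q) 0 i)).
  by apply: nearW => q; rewrite linearD mxE.
by apply: smoothD; apply: sect_smooth.
Qed.
Let mul_smooth (f : smooth_fun M) (x : sect) p :
  smooth_sect_at (fun q => f q *: x q) p.
Proof.
move=> t i bt tp.
apply: (@smooth_fun_ext _ _ _ (fun q => f q * tfun t q (x q) 0 i)).
  by apply: nearW => q; rewrite linearZ mxE.
by apply: smoothM; [exact: sfun_smooth|apply: sect_smooth].
Qed.

Definition sect_zero := Sect zero_smooth.
Definition sect_add x y := Sect (add_smooth x y).
Definition sect_mul (f : smooth_fun M) (x : sect) := Sect (mul_smooth f x).
Definition sect_scale (a : R) (x : sect) := sect_mul (sf_cst M a) x.

Let sect_addA : associative sect_add.
Proof. by move=> x y z; apply: sect_eq => p /=; rewrite addrA. Qed.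
Let sect_addC : commutative sect_add.
Proof. by move=> x y; apply: sect_eq => p /=; rewrite addrC. Qed.
Let sect_add0 : left_id sect_zero sect_add.
Proof. by move=> x; apply: sect_eq => p /=; rewrite add0r. Qed.
Let sect_addN : left_inverse sect_zero (sect_scale (-1)) sect_add.
Proof. by move=> x; apply: sect_eq => p /=; rewrite scaleN1r addNr. Qed.

HB.instance Definition _ :=
  GRing.isZmodule.Build sect sect_addA sect_addC sect_add0 sect_addN.

Let sect_scaleA a b x : sect_scale a (sect_scale b x) = sect_scale (a * b) x.
Proof. by apply: sect_eq => p /=; rewrite scalerA. Qed.
Let sect_scale1 : left_id 1 sect_scale.
Proof. by move=> x; apply: sect_eq => p /=; rewrite scale1r. Qed.
Let sect_scaleDr : right_distributive sect_scale +%R.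
Proof. by move=> a x y; apply: sect_eq => p /=; rewrite scalerDr. Qed.
Let sect_scaleDl x : {morph sect_scale^~ x : a b / a + b}.
Proof. by move=> a b; apply: sect_eq => p /=; rewrite scalerDl. Qed.

HB.instance Definition _ := GRing.Zmodule_isLmodule.Build R sect
  sect_scaleA sect_scale1 sect_scaleDr sect_scaleDl.

End Bundle.

Section AlternatingForms.
Variables (R : realType) (V : lmodType R).

Definition upd k (v : 'I_k -> V) (i : 'I_k) (u : V) : 'I_k -> V :=
  fun j => if j == i then u else v j.

Definition multilinear k (w : ('I_k -> V) -> R) : Prop :=
  forall i v (a : R) u u',
    w (upd v i (a *: u + u')) = a * w (upd v i u) + w (upd v i u').

Definition alternating k (w : ('I_k -> V) -> R) : Prop :=
  forall v i j, i != j -> v i = v j -> w v = 0.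

(* The exterior product normalised so that, on k + l covectors,
   (e^1 /\ .. /\ e^{k+l}) (e_1, .., e_{k+l}) = 1; equivalently the sum over
   (k, l)-shuffles. *)
Definition alt_wedge k l (a : ('I_k -> V) -> R) (b : ('I_l -> V) -> R)
    (v : 'I_(k + l) -> V) : R :=
  ((k`! * l`!)%:R)^-1 *
  \sum_(s : 'S_(k + l)) (-1) ^+ s *
     (a (fun i => v (s (lshift l i))) * b (fun j => v (s (rshift k j)))).

Lemma multilinear_sum k (w : ('I_k -> V) -> R) i v (I : Type) (s : seq I)
    (c : I -> R) (e : I -> V) : multilinear w ->
  w (upd v i (\sum_(j <- s) c j *: e j)) = \sum_(j <- s) c j * w (upd v i (e j)).
Proof.
move=> mw; elim: s => [|j s IH]; last by rewrite !big_cons mw IH.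
rewrite !big_nil; have := mw i v 1 0 0; rewrite scaler0 addr0 mul1r.
by move/eqP; rewrite -subr_eq subrr => /eqP.
Qed.

Lemma alt_wedge_multilinear k l (a : ('I_k -> V) -> R) (b : ('I_l -> V) -> R) :
  multilinear a -> multilinear b -> multilinear (alt_wedge a b).
Proof.
move=> ma mb i v c u u'; rewrite /alt_wedge.
rewrite [c * _]mulrCA -mulrDr [c * _]mulr_sumr -big_split /=; congr (_ * _).
apply: eq_bigr => s _; rewrite [c * _]mulrCA -mulrDr; congr (_ * _).
have si := permKV s i.
case: (splitP ((s^-1)%g i)) => j Ej.
- have ej : (s^-1)%g i = lshift l j by exact: val_inj.
  have eb u0 : (fun j => upd v i u0 (s (rshift k j))) =
      (fun j => v (s (rshift k j))).
    apply/funext => j'; rewrite /upd; case: eqP => // /esym E.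
    by have := canLR (permK s) E; rewrite ej => /eqP; rewrite eq_lrshift.
  have ea u0 : (fun j => upd v i u0 (s (lshift l j))) =
      upd (fun j => v (s (lshift l j))) j u0.
    apply/funext => j'; rewrite /upd -{1}si (inj_eq perm_inj) ej.
    by rewrite eq_lshift.
  by rewrite !eb !ea ma mulrDl mulrA.
- have ej : (s^-1)%g i = rshift k j by exact: val_inj.
  have ea u0 : (fun j => upd v i u0 (s (lshift l j))) =
      (fun j => v (s (lshift l j))).
    apply/funext => j'; rewrite /upd; case: eqP => // /esym E.
    by have := canLR (permK s) E; rewrite ej => /eqP; rewrite eq_rlshift.
  have eb u0 : (fun j => upd v i u0 (s (rshift k j))) =
      upd (fun j => v (s (rshift k j))) j u0.
    apply/funext => j'; rewrite /upd -{1}si (inj_eq perm_inj) ej.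
    by rewrite eq_rshift.
  by rewrite !ea !eb mb mulrDr mulrCA.
Qed.

Lemma alt_wedge_alternating k l (a : ('I_k -> V) -> R) (b : ('I_l -> V) -> R) :
  alternating (alt_wedge a b).
Proof.
move=> v i j ij vij; rewrite /alt_wedge.
set S := \sum_s _; suff : S = - S.
  by move/eqP; rewrite -addr_eq0 -mulr2n mulrn_eq0 /= => /eqP ->; rewrite mulr0.
have vt m : v (tperm i j m) = v m by case: tpermP => // ->.
rewrite {1}/S (reindex_inj (mulIg (tperm i j))) /= -sumrN.
apply: eq_bigr => s _; rewrite odd_permM odd_tperm ij addbT.
rewrite signrN mulNr; congr (- (_ * (a _ * b _))).
  by apply/funext => m; rewrite permM vt.
by apply/funext => m; rewrite permM vt.
Qed.

End AlternatingForms.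

Section Forms.
Variables (R : realType) (n : nat) (M : manifold R n) (r : nat).
Variable A : vbundle M r.

(* Sections of the k-th exterior power of the dual bundle: smooth families of
   alternating k-linear forms on the fibres, smoothness being that of the
   components in the local frames. *)
Record bform (k : nat) := Form {
  fval :> forall p : M, ('I_k -> A p) -> R;
  form_multilinear : forall p, multilinear (@fval p);
  form_alternating : forall p, alternating (@fval p);
  form_smooth : forall p t (J : 'I_k -> 'I_r), batlas t -> tdom t p ->
    smooth_fun_at (fun q => fval (fun i => frame t (J i) q)) p
}.

Section FormModule.
Variable k : nat.
Implicit Types w z : bform k.

Lemma form_eq w z : (forall p (v : 'I_k -> A p), w p v = z p v) -> w = z.
Proof.
case: w z => [w w1 w2 w3] [z z1 z2 z3] /= wz.
have e : w = z.
  by apply: functional_extensionality_dep => p; exact: funext.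
by subst z; congr Form; exact: Prop_irrelevance.
Qed.

HB.instance Definition _ := gen_eqMixin (bform k).
HB.instance Definition _ := gen_choiceMixin (bform k).

Definition form_zero : bform k.
Proof.
exists (fun p v => 0).
- by move=> p i v a u u'; rewrite mulr0 addr0.
- by [].
- by move=> p t J _ _; exact: smooth_cst.
Defined.

Definition form_add w z : bform k.
Proof.
exists (fun p v => w p v + z p v).
- by move=> p i v a u u'; rewrite !form_multilinear mulrDr addrACA.
- by move=> p v i j ij vij; rewrite !(form_alternating _ ij vij) addr0.
- by move=> p t J bt tp; apply: smoothD; exact: form_smooth.
Defined.

Definition form_scale (a : R) w : bform k.
Proof.
exists (fun p v => a * w p v).
- by move=> p i v b u u'; rewrite !form_multilinear mulrDr mulrCA.
- by move=> p v i j ij vij; rewrite (form_alternating _ ij vij) mulr0.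
- move=> p t J bt tp; apply: smoothM; first exact: smooth_cst.
  exact: form_smooth.
Defined.

Let form_addA : associative form_add.
Proof. by move=> x y z; apply: form_eq => p v /=; rewrite addrA. Qed.
Let form_addC : commutative form_add.
Proof. by move=> x y; apply: form_eq => p v /=; rewrite addrC. Qed.
Let form_add0 : left_id form_zero form_add.
Proof. by move=> x; apply: form_eq => p v /=; rewrite add0r. Qed.
Let form_addN : left_inverse form_zero (form_scale (-1)) form_add.
Proof. by move=> x; apply: form_eq => p v /=; rewrite mulN1r addNr. Qed.

HB.instance Definition _ :=
  GRing.isZmodule.Build (bform k) form_addA form_addC form_add0 form_addN.

Let form_scaleA a b x : form_scale a (form_scale b x) = form_scale (a * b) x.
Proof. by apply: form_eq => p v /=; rewrite mulrA. Qed.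
Let form_scale1 : left_id 1 form_scale.
Proof. by move=> x; apply: form_eq => p v /=; rewrite mul1r. Qed.
Let form_scaleDr : right_distributive form_scale +%R.
Proof. by move=> a x y; apply: form_eq => p v /=; rewrite mulrDr. Qed.
Let form_scaleDl x : {morph form_scale^~ x : a b / a + b}.
Proof. by move=> a b; apply: form_eq => p v /=; rewrite mulrDl. Qed.

HB.instance Definition _ := GRing.Zmodule_isLmodule.Build R (bform k)
  form_scaleA form_scale1 form_scaleDr form_scaleDl.

End FormModule.

Definition form_one : bform 0.
Proof.
exists (fun p v => 1).
- by move=> p [].
- by move=> p v [].
- by move=> p t J _ _; exact: smooth_cst.
Defined.

Definition wedge k l (w : bform k) (z : bform l) : bform (k + l).
Proof.
exists (fun p => alt_wedge (w p) (z p)).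
- by move=> p; apply: alt_wedge_multilinear; exact: form_multilinear.
- by move=> p; exact: alt_wedge_alternating.
- move=> p t J bt tp; rewrite /alt_wedge.
  apply: smoothM; first exact: smooth_cst.
  apply: smooth_sum => s _; apply: smoothM; first exact: smooth_cst.
  by apply: smoothM; exact: form_smooth.
Defined.

Lemma form_eval_smooth k (w : bform k) (x : 'I_k -> sect A) p :
  smooth_fun_at (fun q => w q (fun i => x i q)) p.
Proof.
have [t bt tp] := batlas_cover A p.
pose mix (s : seq 'I_k) (J : 'I_k -> 'I_r) q (i : 'I_k) : A q :=
  if i \in s then x i q else frame t (J i) q.
suff H s : forall J, smooth_fun_at (fun q => w q (mix s J q)) p.
  case: (posnP r) => [r0|r_gt0]; last first.
    apply: (@smooth_fun_ext _ _ _
      (fun q => w q (mix (enum 'I_k) (fun=> Ordinal r_gt0) q))) => //.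
    apply: nearW => q; congr (w q _); apply/funext => i.
    by rewrite /mix mem_enum.
  case: (posnP k) => [k0|k_gt0].
    have J : 'I_k -> 'I_r by move=> i; exfalso; case: i => i; rewrite k0.
    apply: (@smooth_fun_ext _ _ _ (fun q => w q (mix (enum 'I_k) J q))) => //.
    apply: nearW => q; congr (w q _); apply/funext => i.
    by rewrite /mix mem_enum.
  apply: (@smooth_fun_ext _ _ _ (fun=> 0)); last exact: smooth_cst.
  have tn : nbhs p (tdom t).
    by apply: open_nbhs_nbhs; split => //; exact: tdom_open.
  apply: filterS tn => q tq.
  pose i0 := Ordinal k_gt0; pose v := fun i => x i q.
  have -> : (fun i => x i q) = upd v i0 (\sum_(j <- [::]) (0 : R) *: v j).
    apply/funext => i; rewrite /upd big_nil; case: eqP => // _.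
    rewrite (frame_decomp (x i q) tq) big1 // => j.
    by exfalso; case: j => j; rewrite r0.
  by rewrite multilinear_sum ?big_nil //; exact: form_multilinear.
elim: s => [|i s IH] J.
  exact: (@form_smooth _ w p t J).
have [si|si] := boolP (i \in s).
  apply: smooth_fun_ext (IH J); apply: nearW => q; congr (w q _).
  by apply/funext => j; rewrite /mix inE; case: eqP => // ->; rewrite si.
pose J' a j := if j == i then a else J j.
apply: (@smooth_fun_ext _ _ _ (fun q => \sum_(a < r)
    tfun t q (x i q) 0 a * w q (mix s (J' a) q))).
  have tn : nbhs p (tdom t).
    by apply: open_nbhs_nbhs; split => //; exact: tdom_open.
  apply: filterS tn => q tq.
  have -> : mix (i :: s) J q = upd (mix s J q) i
      (\sum_(a < r) tfun t q (x i q) 0 a *: frame t a q).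
    apply/funext => j; rewrite /mix /upd inE.
    by case: eqP => // ->; exact: frame_decomp.
  rewrite multilinear_sum; last exact: form_multilinear.
  apply: eq_bigr => a _; congr (_ * w q _); apply/funext => j.
  by rewrite /mix /upd /J'; case: eqP => // ->; rewrite (negPf si).
apply: smooth_sum => a _; apply: smoothM; last exact: IH.
by apply: sect_smooth.
Qed.

Definition form_eval k (w : bform k) (x : 'I_k -> sect A) : smooth_fun M :=
  SmoothFun (form_eval_smooth w x).

(* The form representing an operator on sections (which, if it exists, is
   unique), and 0 if there is none. *)
Definition form_of k (G : ('I_k -> sect A) -> smooth_fun M) : bform k :=
  xget 0 [set w : bform k | forall x, form_eval w x = G x].

End Forms.

Section HomLie.
Variables (R : realType) (g : lmodType R).
Variables (br : g -> g -> g) (phi : g -> g).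

Record is_hom_lie : Prop := IsHomLie {
  bracket_linear_l : forall y, linear (br^~ y);
  bracket_linear_r : forall x, linear (br x);
  bracket_skew : forall x y, br x y = - br y x;
  hom_linear : linear phi;
  hom_bracket : forall x y, phi (br x y) = br (phi x) (phi y);
  hom_jacobi : forall x y z,
    br (phi x) (br y z) + br (phi y) (br z x) + br (phi z) (br x y) = 0
}.

Record is_hom_rep (V : lmodType R) (beta : V -> V) (rho : g -> V -> V) : Prop :=
  IsHomRep {
  rep_beta_linear : linear beta;
  rep_linear_l : forall v, linear (rho^~ v);
  rep_linear_r : forall x, linear (rho x);
  rep_hom : forall x v, rho (phi x) (beta v) = beta (rho x v);
  rep_bracket : forall x y v,
    rho (br x y) (beta v) = rho (phi x) (rho y v) - rho (phi y) (rho x v)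
}.

End HomLie.

Record hom_bundle (R : realType) (n : nat) (M : manifold R n) (r : nat) :=
  HomBundle {
  hb_bundle :> vbundle M r;
  hb_map : smooth_map M;
  hb_phi : sect hb_bundle -> sect hb_bundle;
  hb_phi_linear : linear hb_phi;
  hb_phi_mul : forall f x,
    hb_phi (sect_mul f x) = sect_mul (pullback hb_map f) (hb_phi x)
}.

Arguments hb_phi {R n M r} h _.

Definition hb_invertible (R : realType) (n : nat) (M : manifold R n) (r : nat)
    (A : hom_bundle M r) : Prop :=
  (exists psi : smooth_map M, cancel (hb_map A) psi /\ cancel psi (hb_map A)) /\
  bijective (hb_phi A).

(* The inverse of [hb_phi], meaningful when the Hom-bundle is invertible. *)
Definition hb_phi_inv (R : realType) (n : nat) (M : manifold R n) (r : nat)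
    (A : hom_bundle M r) (y : sect A) : sect A :=
  xget 0 [set x | hb_phi A x = y].

Arguments hb_phi_inv {R n M r} A y.

(* Bundle maps from A to the pullback of TM along phi.  Smoothness: in a local
   frame of A and the local frame (d/dx_i o phi)_i of the pullback bundle given
   by a chart, the components are smooth. *)
Record anchor_map (R : realType) (n : nat) (M : manifold R n) (r : nat)
    (A : vbundle M r) (phi : smooth_map M) := AnchorMap {
  amap :> forall p : M, {linear A p -> tangent (phi p)};
  amap_smooth : forall (t : triv r A) (c : chart R n M) (j : 'I_r),
    batlas t -> atlas c ->
    exists w : M -> 'rV[R]_n, forall p, tdom t p -> cdom c (phi p) ->
      (forall i, smooth_fun_at (fun q => w q 0 i) p) /\
      tangent_coord c (amap p (frame t j p)) (w p)
}.

Section AnchorAction.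
Variables (R : realType) (n : nat) (M : manifold R n) (r : nat).
Variables (A : vbundle M r) (phi : smooth_map M) (a : anchor_map A phi).

Lemma anchor_act_smooth (x : sect A) (f : smooth_fun M) p :
  smooth_fun_at (fun q => a q (x q) f) p.
Proof.
have [t bt tp] := batlas_cover A p.
have [c ac cp] := atlas_cover (phi p).
have [w Hw] := choice (fun j => amap_smooth a j bt ac).
have tn : nbhs p (tdom t).
  by apply: open_nbhs_nbhs; split => //; exact: tdom_open.
have cn' : nbhs (phi p) (cdom c).
  by apply: open_nbhs_nbhs; split => //; exact: cdom_open.
have cn : nbhs p (phi @^-1` cdom c).
  by exact: (@smap_continuous _ _ _ phi p _ cn').
have tan0 q (v : tangent q) (s : seq 'I_r) (F : 'I_r -> tangent q)
    (b : 'I_r -> R) : (\sum_(j <- s) b j *: F j : tangent q) f =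
    \sum_(j <- s) b j * F j f.
  elim: s => [|j s IH]; first by rewrite !big_nil.
  by rewrite !big_cons -IH.
apply: (@smooth_fun_ext _ _ _ (fun q => \sum_(j < r) tfun t q (x q) 0 j *
    \sum_(i < n) w j q 0 i *
      'D_(delta_mx 0 i) (f \o cinv c) (cmap c (phi q)))).
  apply: filterS2 tn cn => q tq cq.
  rewrite {2}(frame_decomp (x q) tq) linear_sum.
  under [X in _ = tval X _]eq_bigr do rewrite linearZ.
  rewrite tan0; last exact: 0.
  apply: eq_bigr => j _; congr (_ * _).
  rewrite ((Hw j q tq cq).2 f) derive_sum_coord //.
  exact: (nbhs_singleton (sfun_smooth f ac cq 1).1).
apply: smooth_sum => j _; apply: smoothM; first by apply: sect_smooth.
apply: smooth_sum => i _; apply: smoothM; first exact: (Hw j p tp cp).1.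
apply: (@smooth_chart_comp _ _ _ phi c
  (fun u => 'D_(delta_mx 0 i) (f \o cinv c) u)) => // k.
exact: ((sfun_smooth f ac cp k.+1).2 (delta_mx 0 i)).
Qed.

Definition anchor_act (x : sect A) (f : smooth_fun M) : smooth_fun M :=
  SmoothFun (anchor_act_smooth x f).

End AnchorAction.

Record hom_lie_algebroid (R : realType) (n : nat) (M : manifold R n)
    (r : nat) := HomLieAlgebroid {
  hla_bundle :> hom_bundle M r;
  hla_bracket : sect hla_bundle -> sect hla_bundle -> sect hla_bundle;
  hla_anchor : anchor_map hla_bundle (hb_map hla_bundle);
  hla_hom_lie : is_hom_lie hla_bracket (hb_phi hla_bundle);
  hla_leibniz : forall x y (f : smooth_fun M),
    hla_bracket x (sect_mul f y) =
      sect_mul (pullback (hb_map hla_bundle) f) (hla_bracket x y) +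
      sect_mul (anchor_act hla_anchor (hb_phi hla_bundle x) f)
        (hb_phi hla_bundle y);
  hla_rep : is_hom_rep hla_bracket (hb_phi hla_bundle)
    (pullback (hb_map hla_bundle)) (anchor_act hla_anchor)
}.

Section Differential.
Variables (R : realType) (n : nat) (M : manifold R n) (r : nat).
Variable A : hom_lie_algebroid M r.

(* The right-hand side of the definition of phi_A^dagger, evaluated on
   X = x_1 /\ .. /\ x_k. *)
Definition dagger_rhs k (w : bform A k) (x : 'I_k -> sect A) : smooth_fun M :=
  pullback (hb_map A) (form_eval w (fun i => hb_phi_inv A (x i))).

(* Forms are determined by their values on sections, see [form_of]. *)
Definition dagger k (w : bform A k) : bform A k := form_of (dagger_rhs w).

(* The arguments [phi^-1 x_i, phi^-1 x_j], x_1, .., x_{k+1} with x_i and x_j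
   omitted. *)
Definition bracket_args k (x : 'I_k.+1 -> sect A) (i j : 'I_k.+1) :
    'I_k -> sect A :=
  fun m => nth 0
    (hla_bracket (hb_phi_inv A (x i)) (hb_phi_inv A (x j)) ::
     [seq x l | l <- enum 'I_k.+1 & (l != i) && (l != j)]) m.

(* Indices start at 0 here, which does not affect the parity of i + 1
   (1-based, hence i + 2) and of i + j. *)
Definition hom_diff_rhs k (w : bform A k) (x : 'I_k.+1 -> sect A) : smooth_fun M :=
  \sum_(i < k.+1) (-1 : R) ^+ i *:
     anchor_act (hla_anchor A) (x i)
       (form_eval w (fun j => hb_phi_inv A (x (lift i j)))) +
  \sum_(i < k.+1) \sum_(j < k.+1 | (i < j)%N) (-1 : R) ^+ (i + j) *:
     form_eval (dagger w) (bracket_args x i j).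

Definition hom_diff k (w : bform A k) : bform A k.+1 := form_of (hom_diff_rhs w).

End Differential.

(* A graded algebra is given by its homogeneous components C k; [gcast] is the
   transport along an equality of degrees. *)
Definition gcast (R : realType) (C : nat -> lmodType R) (k l : nat)
    (e : k = l) (a : C k) : C l := eq_rect k (fun m => C m) a l e.

Section GradedAlgebras.
Variables (R : realType) (C : nat -> lmodType R).
Variables (one : C 0) (mul : forall k l, C k -> C l -> C (k + l)).

Record is_graded_comm_algebra : Prop := IsGradedCommAlgebra {
  gmul_linear_l : forall k l (b : C l), linear (fun a : C k => mul a b);
  gmul_linear_r : forall k l (a : C k), linear (fun b : C l => mul a b);
  gmulA : forall k l m (a : C k) (b : C l) (c : C m),
    mul (mul a b) c = gcast (addnA k l m) (mul a (mul b c));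
  gmul1l : forall k (a : C k), mul one a = a;
  gmul1r : forall k (a : C k), gcast (addn0 k) (mul a one) = a;
  gmulC : forall k l (a : C k) (b : C l),
    mul a b = (-1) ^+ (k * l) *: gcast (addnC l k) (mul b a)
}.

Record is_graded_endo (sigma : forall k, C k -> C k) : Prop := IsGradedEndo {
  gendo_linear : forall k, linear (sigma k);
  gendo1 : sigma 0 one = one;
  gendoM : forall k l (a : C k) (b : C l),
    sigma (k + l)%N (mul a b) = mul (sigma k a) (sigma l b)
}.

Record is_dgca (sigma tau : forall k, C k -> C k)
    (d : forall k, C k -> C k.+1) : Prop := IsDGCA {
  dgca_algebra : is_graded_comm_algebra;
  dgca_sigma : is_graded_endo sigma;
  dgca_tau : is_graded_endo tau;
  dgca_d_linear : forall k, linear (d k);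
  dgca_dd : forall k (a : C k), d k.+1 (d k a) = 0;
  dgca_d_sigma : forall k (a : C k), d k (sigma k a) = sigma k.+1 (d k a);
  dgca_d_tau : forall k (a : C k), d k (tau k a) = tau k.+1 (d k a);
  dgca_leibniz : forall k l (a : C k) (b : C l),
    d (k + l)%N (mul a b) =
      (mul (d k a) (tau l b) : C (k + l).+1) +
      (-1) ^+ k *: gcast (addnS k l) (mul (sigma k a) (d l b))
}.

End GradedAlgebras.

(* Main.v *)
Require Import Defs.
From mathcomp Require Import all_boot all_order all_algebra all_fingroup.
From mathcomp Require Import boolp classical_sets functions reals.
From mathcomp Require Import interval_inference topology normedtype sequences.
From mathcomp Require Import derive realfun exp ring.
Set Implicit Arguments.
Unset Strict Implicit.
Unset Printing Implicit Defensive.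
Import Order.TTheory GRing.Theory Num.Theory.
Import numFieldNormedType.Exports.
Local Open Scope ring_scope.

(* Since phi_A is invertible, [x, y]' = phi_A^-1 [x, y] and
   a'(x) f = (a(phi_A x) f) o varphi^-1 define an ordinary Lie algebroid, of
   which phi_A is an automorphism, and the differential factors as
   d = phi_A^dagger o d' with d' the Chevalley-Eilenberg differential.  So
   d^2 = 0 and the twisted Leibniz rule follow from the classical facts for d' and from
   phi_A^dagger being an algebra automorphism commuting with d'.

   For d', a form is encoded as a function of lists of sections, all degrees
   at once.  Contraction with x is then w |-> w (x :: _), and the exterior
   product, the Lie derivative and d' are defined by recursion on the list from
   the way they (anti)commute with contractions; every identity of the Cartan
   calculus becomes an induction on the list of arguments.

   That the formulas for phi_A^dagger and d define smooth forms at all is the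
   tensoriality lemma: a C^oo(M)-multilinear alternating operator on global
   sections is pointwise, because bump functions cut local frames off to global
   sections. *)

(** * Forms as functions of argument lists *)

Lemma morph_add0 (V W : zmodType) (f : V -> W) : {morph f : x y / x + y} -> f 0 = 0.
Proof. by move=> fD; apply: (addrI (f 0)); rewrite -fD !addr0. Qed.

Lemma morph_addN (V W : zmodType) (f : V -> W) :
  {morph f : x y / x + y} -> {morph f : x / - x}.
Proof.
by move=> fD x; apply: (addrI (f x)); rewrite -fD !subrr (morph_add0 fD).
Qed.

Section Shuffle.
Variables (F : comPzRingType) (L : Type).
Implicit Types (u v w : seq L -> F) (x y z : L) (s : seq L) (f : F).

Definition contract x w : seq L -> F := fun s => w (x :: s).

Definition scale_form f w : seq L -> F := fun s => f * w s.

(** The grading involution: the sign that a contraction picks up when it passes the first factor of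
    a product. *)
Definition parity w : seq L -> F := fun s => (-1) ^+ size s * w s.

Definition zero_form f : seq L -> F := fun s => if s is [::] then f else 0.

Definition has_parity (e : bool) w := forall s, odd (size s) != e -> w s = 0.

(** The exterior product. The recursive clause is the graded Leibniz rule [i_x (u /\ v) = i_x u /\ v
    + (-1)^|u| u /\ i_x v]. *)
Fixpoint shuffle u v s : F :=
  if s is x :: s' then
    shuffle (contract x u) v s' + shuffle (parity u) (contract x v) s'
  else u [::] * v [::].

Lemma contractD x u v : contract x (u + v) = contract x u + contract x v.
Proof. by []. Qed.

Lemma contractZ x f u : contract x (scale_form f u) = scale_form f (contract x u).
Proof. by []. Qed.

Lemma contract_shuffle x u v : contract x (shuffle u v) =
  shuffle (contract x u) v + shuffle (parity u) (contract x v).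
Proof. by []. Qed.

Lemma contract_zero_form x f : contract x (zero_form f) = 0.
Proof. by []. Qed.

Lemma scale_formN1 u : scale_form (-1) u = - u.
Proof. by apply: funext => s; rewrite /scale_form mulN1r. Qed.

Lemma scale_form1 u : scale_form 1 u = u.
Proof. by apply: funext => s; rewrite /scale_form mul1r. Qed.

Lemma scale_form0 u : scale_form 0 u = 0.
Proof. by apply: funext => s; rewrite /scale_form mul0r. Qed.

Lemma parityD u v : parity (u + v) = parity u + parity v.
Proof. by apply: funext => s; apply: mulrDr. Qed.

Lemma parityZ f u : parity (scale_form f u) = scale_form f (parity u).
Proof. by apply: funext => s; apply: mulrCA. Qed.

Lemma parityK u : parity (parity u) = u.
Proof.
by apply: funext => s; rewrite /parity mulrA -expr2 sqrr_sign mul1r.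
Qed.

Lemma contract_parity x w : contract x (parity w) = - parity (contract x w).
Proof.
by apply: funext => s; rewrite /contract /parity /= exprS mulN1r mulNr.
Qed.

Lemma shuffleDl u u' v : shuffle (u + u') v = shuffle u v + shuffle u' v.
Proof.
apply: funext => s; elim: s u u' v => [|x s IH] u u' v /=; first exact: mulrDl.
by rewrite contractD parityD !IH addrACA.
Qed.

Lemma shuffleDr u v v' : shuffle u (v + v') = shuffle u v + shuffle u v'.
Proof.
apply: funext => s; elim: s u v v' => [|x s IH] u v v' /=; first exact: mulrDr.
by rewrite contractD !IH addrACA.
Qed.

Lemma shuffleZl f u v : shuffle (scale_form f u) v = scale_form f (shuffle u v).
Proof.
apply: funext => s; elim: s u v => [|x s IH] u v /=.
  by rewrite /scale_form /= mulrA.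
by rewrite contractZ parityZ !IH /scale_form mulrDr.
Qed.

Lemma shuffleZr f u v : shuffle u (scale_form f v) = scale_form f (shuffle u v).
Proof.
apply: funext => s; elim: s u v => [|x s IH] u v /=.
  by rewrite /scale_form /= mulrCA.
by rewrite contractZ !IH /scale_form mulrDr.
Qed.

Lemma shuffleNl u v : shuffle (- u) v = - shuffle u v.
Proof. by rewrite -!scale_formN1 shuffleZl. Qed.

Lemma shuffleNr u v : shuffle u (- v) = - shuffle u v.
Proof. by rewrite -!scale_formN1 shuffleZr. Qed.

Lemma parity_shuffle u v : parity (shuffle u v) = shuffle (parity u) (parity v).
Proof.
apply: funext => s; elim: s u v => [|x s IH] u v.
  by rewrite /= /parity /= !expr0 !mul1r.
rewrite /= !contract_parity shuffleNl shuffleNr !fctE -!IH.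
by rewrite /parity /= exprS mulN1r mulNr mulrDr opprD.
Qed.

(** After one contraction both sides are the same three products, with [u], [v] or [w] contracted;
    the signs agree because [parity] is multiplicative. *)
Lemma shuffleA u v w : shuffle (shuffle u v) w = shuffle u (shuffle v w).
Proof.
apply: funext => s; elim: s u v w => [|x s IH] u v w; first by rewrite /= mulrA.
rewrite /= parity_shuffle !contract_shuffle shuffleDl shuffleDr !fctE !IH.
exact/esym/addrA.
Qed.

Lemma has_parityE e w : has_parity e w -> parity w = scale_form ((-1) ^+ e) w.
Proof.
move=> pw; apply: funext => s; rewrite /parity /scale_form -signr_odd.
by have [->//|/pw ->] := eqVneq (odd (size s)) e; rewrite !mulr0.
Qed.

Lemma has_parity_contract e x w :
  has_parity e w -> has_parity (~~ e) (contract x w).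
Proof. by move=> pw s se; apply: pw => /=; move: se; case: odd; case: (e). Qed.

(** The sign depends only on the two parities, and each contraction flips one of them, so parities
    rather than degrees are carried through the induction. *)
Lemma shuffleC e e' u v : has_parity e u -> has_parity e' v ->
  shuffle u v = scale_form ((-1) ^+ (e && e')) (shuffle v u).
Proof.
move=> pu pv; apply: funext => s.
elim: s e e' u v pu pv => [|x s IH] e e' u v pu pv.
  rewrite /scale_form /=; case: e pu => pu; last by rewrite mul1r mulrC.
  by rewrite (pu [::]) // mul0r !mulr0.
rewrite /scale_form /= (has_parityE pu) (has_parityE pv) !shuffleZl.
rewrite (IH _ _ _ _ (has_parity_contract x pu) pv) /scale_form.
rewrite (IH _ _ _ _ pu (has_parity_contract x pv)) /scale_form.
rewrite mulrDr !mulrA -!signr_addb addrC.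
by case: e {pu}; case: e' {pv}.
Qed.

Lemma shuffle_zero_form f w : shuffle (zero_form f) w = scale_form f w.
Proof.
apply: funext => s; elim: s w => [|x s IH] w //=.
rewrite contract_zero_form -(scale_form0 (zero_form f)) shuffleZl scale_form0.
rewrite [parity _](_ : _ = zero_form f) ?IH ?add0r //.
by apply: funext => -[|y t]; rewrite /parity /= ?mulr0 // expr0 mul1r.
Qed.

Lemma zero_form_parity f : has_parity false (zero_form f).
Proof. by case. Qed.

End Shuffle.

Section AlternatingSeqForms.
Variables (F : comPzRingType) (L : zmodType) (smul : F -> L -> L).
Implicit Types (u v w : seq L -> F) (x y z : L) (s t : seq L) (f g : F).

(** The alternating axiom concerns adjacent arguments, a shape that inductions on the prefix [s]
    preserve; [form_swap] and [form_repeat] recover the general case. No degree is imposed. *)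
Record is_form w : Prop := IsForm {
  formD : forall s t x y, w (s ++ (x + y) :: t) = w (s ++ x :: t) + w (s ++ y :: t);
  formZ : forall s t f x, w (s ++ smul f x :: t) = f * w (s ++ x :: t);
  form_alt : forall s t x, w (s ++ x :: x :: t) = 0
}.

Lemma is_form_contract x w : is_form w -> is_form (contract x w).
Proof.
case=> wD wZ wA; split=> s t *; first exact: (wD (x :: s)).
  exact: (wZ (x :: s)).
exact: (wA (x :: s)).
Qed.

(** Polarisation: expand [w] on the repeated argument [x + y]. *)
Lemma form_swap w : is_form w ->
  forall s t x y, w (s ++ x :: y :: t) = - w (s ++ y :: x :: t).
Proof.
move=> [wD _ wA] s t x y; apply/eqP; rewrite -addr_eq0.
have D a : w (s ++ a :: (x + y) :: t) = w (s ++ a :: x :: t) + w (s ++ a :: y :: t).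
  by rewrite -!(cat_rcons a) wD.
by have := wA s t (x + y); rewrite wD !D !wA add0r addr0 => ->.
Qed.

Lemma contractDl w x y : is_form w -> contract (x + y) w = contract x w + contract y w.
Proof. by move=> fw; apply: funext => s; apply: (formD fw [::]). Qed.

Lemma contractZl w f x : is_form w -> contract (smul f x) w = scale_form f (contract x w).
Proof. by move=> fw; apply: funext => s; apply: (formZ fw [::]). Qed.

Lemma form0 w : is_form w -> forall s t, w (s ++ 0 :: t) = 0.
Proof. by move=> fw s t; exact: (morph_add0 (formD fw s t)). Qed.

Lemma formN w : is_form w -> forall s t x, w (s ++ - x :: t) = - w (s ++ x :: t).
Proof. by move=> fw s t; exact: (morph_addN (formD fw s t)). Qed.

Lemma contractxx w x : is_form w -> contract x (contract x w) = 0.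
Proof. by move=> fw; apply: funext => s; apply: (form_alt fw [::]). Qed.

Lemma contractC w x y : is_form w ->
  contract x (contract y w) = - contract y (contract x w).
Proof. by move=> fw; apply: funext => s; apply: (form_swap fw [::]). Qed.

End AlternatingSeqForms.

(** * Cartan calculus of a Lie-Rinehart algebra *)

Section LieRinehart.
Variables (F : comPzRingType) (L : zmodType) (smul : F -> L -> L).
Variables (br : L -> L -> L) (act : L -> F -> F).
Implicit Types (u v w : seq L -> F) (x y z : L) (s t : seq L) (f g : F).

(** The algebraic counterpart of a Lie algebroid. [lr_brxx] stands beside [lr_skew] because [L] may
    have 2-torsion. *)
Record is_lie_rinehart : Prop := IsLieRinehart {
  lr_brDr : forall x y z, br x (y + z) = br x y + br x z;
  lr_brxx : forall x, br x x = 0;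
  lr_skew : forall x y, br x y = - br y x;
  lr_jacobi : forall x y z, br x (br y z) = br (br x y) z + br y (br x z);
  lr_leibniz : forall x f y, br x (smul f y) = smul f (br x y) + smul (act x f) y;
  lr_actD : forall x f g, act x (f + g) = act x f + act x g;
  lr_actM : forall x f g, act x (f * g) = act x f * g + f * act x g;
  lr_actDl : forall x y f, act (x + y) f = act x f + act y f;
  lr_actZl : forall f x g, act (smul f x) g = f * act x g;
  lr_act_br : forall x y f, act (br x y) f = act x (act y f) - act y (act x f)
}.

Hypothesis LR : is_lie_rinehart.

(* Cartan's formulas [L_x, i_y] = i_[x,y] and i_x d = L_x - d i_x, read as
   recursive definitions. *)
Fixpoint lie x w s : F :=
  if s is y :: s' then lie x (contract y w) s' - w (br x y :: s')
  else act x (w [::]).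

Fixpoint cediff w s : F :=
  if s is x :: s' then lie x w s' - cediff (contract x w) s' else 0.

Lemma contract_lie x y w :
  contract y (lie x w) = lie x (contract y w) - contract (br x y) w.
Proof. by []. Qed.

Lemma contract_cediff x w :
  contract x (cediff w) = lie x w - cediff (contract x w).
Proof. by []. Qed.

Lemma act0 x : act x 0 = 0.
Proof. exact: (morph_add0 (lr_actD LR x)). Qed.

Lemma lieD x u v : lie x (u + v) = lie x u + lie x v.
Proof.
apply: funext => s; elim: s u v => [|y s IH] u v /=; first exact: lr_actD.
by rewrite contractD IH !fctE opprD addrACA.
Qed.

Lemma lie0 x : lie x 0 = 0.
Proof. exact: (morph_add0 (lieD x)). Qed.

Lemma lieN x u : lie x (- u) = - lie x u.
Proof. exact: (morph_addN (lieD x)). Qed.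

Lemma lieZ x f u : lie x (scale_form f u) =
  scale_form f (lie x u) + scale_form (act x f) u.
Proof.
apply: funext => s; elim: s u => [|y s IH] u.
  by rewrite /= (lr_actM LR) addrC.
by rewrite /= contractZ IH !fctE /scale_form /= /contract; ring.
Qed.

Lemma lieB x u v : lie x (u - v) = lie x u - lie x v.
Proof. by rewrite lieD lieN. Qed.

Lemma lieDl x y u : is_form smul u -> lie (x + y) u = lie x u + lie y u.
Proof.
move=> fu; apply: funext => s; elim: s u fu => [|z s IH] u fu /=.
  exact: lr_actDl.
rewrite IH; last exact: is_form_contract.
have -> : br (x + y) z = br x z + br y z.
  by rewrite (lr_skew LR) (lr_brDr LR) opprD -!(lr_skew LR).
by rewrite !fctE (formD fu [::]) /= opprD addrACA.
Qed.

Lemma cediffD u v : cediff (u + v) = cediff u + cediff v.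
Proof.
apply: funext => s; elim: s u v => [|x s IH] u v /=; first by rewrite !fctE addr0.
by rewrite contractD lieD IH !fctE /= opprD addrACA.
Qed.

Lemma cediff0 : cediff 0 = 0.
Proof. exact: (morph_add0 cediffD). Qed.

Lemma cediffN u : cediff (- u) = - cediff u.
Proof. exact: (morph_addN cediffD). Qed.

Lemma cediff_zero_form f x : contract x (cediff (zero_form f)) = zero_form (act x f).
Proof.
apply: funext => -[|y s]; rewrite contract_cediff contract_zero_form cediff0 subr0 //=.
by rewrite contract_zero_form lie0 subr0.
Qed.

Lemma parity_lie x w : parity (lie x w) = lie x (parity w).
Proof.
apply: funext => s; elim: s w => [|y s IH] w; first by rewrite /parity /= !mul1r.
rewrite /= contract_parity lieN !fctE -IH /parity /= !exprS.
ring.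
Qed.

(** The sign appears because [cediff] raises the degree by one. *)
Lemma parity_cediff w : parity (cediff w) = - cediff (parity w).
Proof.
apply: funext => s; elim: s w => [|x s IH] w.
  by rewrite /parity /= !fctE mulr0 oppr0.
rewrite !fctE /= contract_parity cediffN -parity_lie !fctE.
have -> : cediff (parity (contract x w)) s = - parity (cediff (contract x w)) s.
  by rewrite IH !fctE opprK.
by rewrite /parity /= exprS; ring.
Qed.

Lemma lie_shuffle x u v :
  lie x (shuffle u v) = shuffle (lie x u) v + shuffle u (lie x v).
Proof.
apply: funext => s; elim: s u v => [|y s IH] u v; first exact: lr_actM.
rewrite !fctE /= contract_shuffle !contract_lie lieD !fctE !IH.
rewrite !shuffleDl !shuffleDr !shuffleNl !shuffleNr !fctE parity_lie.
ring.
Qed.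

(** Contraction with [x] replaces [d] by [L_x - d i_x]: the first part is a derivation by
    [lie_shuffle], the second is the induction hypothesis. *)
Lemma cediff_shuffle u v :
  cediff (shuffle u v) = shuffle (cediff u) v + shuffle (parity u) (cediff v).
Proof.
apply: funext => s; elim: s u v => [|x s IH] u v.
  by rewrite !fctE /= mulr0 mul0r addr0.
rewrite !fctE /= contract_shuffle !contract_cediff contract_parity parityK.
rewrite lie_shuffle cediffD !fctE !IH parity_cediff.
rewrite !shuffleDl !shuffleDr !shuffleNl !shuffleNr !fctE.
by rewrite parityK; ring.
Qed.

(** Contraction with [z] leaves a discrepancy that is exactly the Jacobi identity; on the empty list
    the claim is [lr_act_br]. *)
Lemma lie_br x y w : is_form smul w ->
  lie (br x y) w = lie x (lie y w) - lie y (lie x w).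
Proof.
move=> fw; apply: funext => s; elim: s w fw => [|z s IH] w fw.
  exact: lr_act_br.
rewrite !fctE /= !contract_lie !lieB !fctE IH; last exact: is_form_contract.
have -> : br (br x y) z = br x (br y z) - br y (br x z).
  by rewrite (lr_jacobi LR) addrK.
have -> : w (br x (br y z) - br y (br x z) :: s) =
    w (br x (br y z) :: s) - w (br y (br x z) :: s).
  by rewrite (formD fw [::]) (formN fw [::]).
by rewrite !fctE; ring.
Qed.

Lemma is_form_lie x w : is_form smul w -> is_form smul (lie x w).
Proof.
move=> fw.
have [e1 e2 e3] : [/\ forall s t y z,
    lie x w (s ++ (y + z) :: t) = lie x w (s ++ y :: t) + lie x w (s ++ z :: t),
  forall s t f y, lie x w (s ++ smul f y :: t) = f * lie x w (s ++ y :: t) &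
  forall s t y, lie x w (s ++ y :: y :: t) = 0]; last by split.
split=> s.
- elim: s w fw => [|a s IH] w fw t y z /=.
    rewrite (contractDl _ _ fw) lieD !fctE (lr_brDr LR) (formD fw [::]) /=.
    by rewrite opprD addrACA.
  rewrite IH; last exact: is_form_contract.
  by rewrite (formD fw (br x a :: s)) /= opprD addrACA.
- elim: s w fw => [|a s IH] w fw t f y /=.
    (* The two terms in [act x f], one from [lieZ] and one from the Leibniz rule of the bracket,
       cancel. *)
    rewrite (contractZl _ _ fw) lieZ !fctE (lr_leibniz LR) (formD fw [::]) /=.
    by rewrite !(formZ fw [::]) /scale_form /contract /=; ring.
  rewrite IH; last exact: is_form_contract.
  by rewrite (formZ fw (br x a :: s)) /= mulrBr.
- elim: s w fw => [|a s IH] w fw t y /=.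
    rewrite (contractxx _ fw) lie0 /contract.
    by rewrite (form_swap fw [::]) opprK add0r /= subrr.
  rewrite IH; last exact: is_form_contract.
  by rewrite (form_alt fw (br x a :: s)) subr0.
Qed.

(** The terms in [act y f] produced by the brackets of [smul f x] with the arguments assemble into
    the product of [df] with [i_x w]. This correction is what makes [cediff w] linear over
    functions. *)
Lemma lieZl f x w : is_form smul w -> lie (smul f x) w =
  scale_form f (lie x w) + shuffle (cediff (zero_form f)) (contract x w).
Proof.
move=> fw; apply: funext => s; elim: s w fw => [|y s IH] w fw.
  by rewrite !fctE /= lr_actZl // mul0r addr0.
have brl : br (smul f x) y = - (smul f (br y x) + smul (act y f) x).
  by rewrite (lr_skew LR) (lr_leibniz LR).
rewrite !fctE /= IH; last exact: is_form_contract.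
rewrite brl (formN fw [::]) (formD fw [::]) !(formZ fw [::]) /=.
rewrite cediff_zero_form shuffle_zero_form parity_cediff.
rewrite (has_parityE (zero_form_parity f)) scale_form1 shuffleNl.
rewrite (contractC x y fw) shuffleNr !fctE /scale_form /= (lr_skew LR x y).
by rewrite (formN fw [::]) /contract /=; ring.
Qed.

Lemma cediffZ f w : cediff (scale_form f w) =
  scale_form f (cediff w) + shuffle (cediff (zero_form f)) w.
Proof.
rewrite -!shuffle_zero_form cediff_shuffle addrC.
by rewrite (has_parityE (zero_form_parity f)) scale_form1.
Qed.

Lemma contractDl_cediff x y w : is_form smul w ->
  contract (x + y) (cediff w) = contract x (cediff w) + contract y (cediff w).
Proof.
move=> fw; rewrite !contract_cediff (lieDl _ _ fw) (contractDl _ _ fw).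
by rewrite cediffD opprD addrACA.
Qed.

Lemma is_form_cediff w : is_form smul w -> is_form smul (cediff w).
Proof.
move=> fw.
have [e1 e2 e3] : [/\ forall s w, is_form smul w -> forall t y z,
    cediff w (s ++ (y + z) :: t) = cediff w (s ++ y :: t) + cediff w (s ++ z :: t),
  forall s w, is_form smul w -> forall t f y,
    cediff w (s ++ smul f y :: t) = f * cediff w (s ++ y :: t) &
  forall s w, is_form smul w -> forall t y, cediff w (s ++ y :: y :: t) = 0];
  last by split=> s *; [exact: e1|exact: e2|exact: e3].
split=> s; elim: s => [|a s IH] {fw} w fw.
- by move=> t y z; have /(congr1 (@^~ t)) := contractDl_cediff y z fw.
- move=> t y z /=; rewrite (formD (is_form_lie a fw)) IH.
    by rewrite opprD addrACA.
  exact: is_form_contract.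
(* The product [df /\ i_y w] occurs in both [L_(f y) w] and [d (f i_y w)], and cancels in their
   difference. *)
- move=> t f y /=; rewrite (lieZl f y fw) (contractZl _ _ fw) cediffZ.
  by rewrite /scale_form !fctE; ring.
- move=> t f y /=; rewrite (formZ (is_form_lie a fw)) IH ?mulrBr //.
  exact: is_form_contract.
- move=> t y /=; rewrite (lr_brxx LR) (form0 fw [::]) (contractxx _ fw) cediff0.
  by rewrite !subr0 subrr.
- move=> t y /=; rewrite (form_alt (is_form_lie a fw)) IH ?subr0 //.
  exact: is_form_contract.
Qed.

(** After contraction with [y] the terms without a shorter form under both operators are those of
    [lie_br]. *)
Lemma cediff_lie x w : is_form smul w -> cediff (lie x w) = lie x (cediff w).
Proof.
move=> fw; apply: funext => s; elim: s w fw => [|y s IH] w fw /=.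
  by rewrite act0.
have fyw := is_form_contract y fw.
rewrite contract_lie contract_cediff -scale_formN1 cediffD lieB !fctE.
rewrite -(IH _ fyw) scale_formN1 cediffN (lie_br _ _ fw) !fctE.
ring.
Qed.

(** [i_x d d = L_x d - d i_x d = L_x d - d L_x + d d i_x]: the first two terms cancel by
    [cediff_lie], the last vanishes by induction. *)
Lemma cediff_cediff w : is_form smul w -> cediff (cediff w) = 0.
Proof.
move=> fw; apply: funext => s; elim: s w fw => [|x s IH] w fw //=.
have fxw := is_form_contract x fw.
rewrite contract_cediff cediffD cediffN !fctE (IH _ fxw).
by rewrite (cediff_lie _ fw) opprD opprK addr0 subrr.
Qed.

End LieRinehart.

(** * Expansion of the recursive differential into an explicit sum *)

Definition sel (T : Type) (P : pred nat) (s : seq T) : seq T :=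
  mask [seq P i | i <- iota 0 (size s)] s.

Lemma eq_sel (T : Type) (P Q : pred nat) (s : seq T) : P =1 Q -> sel P s = sel Q s.
Proof. by move=> PQ; rewrite /sel (eq_map PQ). Qed.

Lemma sel_cons (T : Type) (P : pred nat) (x : T) s :
  sel P (x :: s) = nseq (P 0) x ++ sel (P \o succn) s.
Proof. by rewrite /sel /= (iotaDl 1 0) -map_comp; case: (P 0). Qed.

Lemma sel_predT (T : Type) (P : pred nat) (s : seq T) : P =1 predT -> sel P s = s.
Proof.
elim: s P => [|x s IH] P aP //; rewrite sel_cons aP IH // => i; exact: aP.
Qed.

Lemma sum_ord_recl_cond (V : nmodType) n (P : pred 'I_n.+1) (f : 'I_n.+1 -> V) :
  \sum_(j < n.+1 | P j) f j = (if P ord0 then f ord0 else 0) +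
    \sum_(j < n | P (lift ord0 j)) f (lift ord0 j).
Proof. by rewrite big_mkcond big_ord_recl -big_mkcond. Qed.

Section ExplicitDifferential.
Variables (F : comPzRingType) (L : zmodType) (smul : F -> L -> L).
Variables (br : L -> L -> L) (act : L -> F -> F).
Hypothesis LR : is_lie_rinehart smul br act.
Implicit Types (w : seq L -> F) (x : L) (s : seq L).

(** Each bracket is moved to the front of the list, and every transposition on the way contributes
    one factor of [(-1) ^+ j]. *)
Lemma lieE x w s : is_form smul w -> lie br act x w s = act x (w s) -
  \sum_(j < size s) (-1) ^+ j * w (br x (nth 0 s j) :: sel (predC1 (j : nat)) s).
Proof.
elim: s w => [|y s IH] w fw; first by rewrite big_ord0 subr0.
rewrite /= IH; last exact: is_form_contract.
rewrite big_ord_recl /= mul1r sel_cons /= sel_predT // /contract -addrA -opprD.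
congr (_ - _); rewrite addrC; congr (_ + _); apply: eq_bigr => i _.
rewrite sel_cons /= (form_swap fw [::]) exprS mulN1r mulNr mulrN /=.
by congr (- (_ * w (_ :: _ :: _))); apply: eq_sel.
Qed.

(** The summands with [i = 0] are those of [lieE]; the others are the induction hypothesis for
    [contract x w]. In the double sum both exponents shift, and the minus sign of the recursion is
    absorbed by swapping [x] with the bracket. *)
Lemma cediffE w s : is_form smul w -> cediff br act w s =
  \sum_(i < size s) (-1) ^+ i * act (nth 0 s i) (w (sel (predC1 (i : nat)) s)) +
  \sum_(i < size s) \sum_(j < size s | (i < j)%N) (-1) ^+ (i + j) *
    w (br (nth 0 s i) (nth 0 s j) ::
       sel (fun l => (l != i :> nat) && (l != j :> nat)) s).
Proof.
elim: s w => [|x s IH] w fw; first by rewrite !big_ord0 addr0.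
rewrite /= IH ?lieE //; last exact: is_form_contract.
rewrite [X in _ = X + _]big_ord_recl [X in _ = _ + X]big_ord_recl /= mul1r.
rewrite sel_cons /= sel_predT // sum_ord_recl_cond /= add0r.
rewrite opprD addrACA; congr (_ + _ + (_ + _)); rewrite -sumrN; apply: eq_bigr => i _.
- rewrite sel_cons /= exprS mulN1r mulNr.
  by congr (- (_ * act _ (w (_ :: _)))); apply: eq_sel.
- rewrite add0n exprS mulN1r mulNr sel_cons /=.
  by congr (- (_ * w (_ :: _))); apply: eq_sel.
- rewrite sum_ord_recl_cond /= add0r -sumrN; apply: eq_big => // j ij.
  rewrite /contract sel_cons /= (form_swap fw [::]) addSn addnS !exprS.
  rewrite !mulN1r opprK mulrN opprK.
  by congr (_ * w (_ :: _ :: _)); apply: eq_sel.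
Qed.

End ExplicitDifferential.

(** * Transport of forms along an automorphism *)

Section Twist.
Variables (F : comPzRingType) (L : zmodType) (smul : F -> L -> L).
Variables (br : L -> L -> L) (act : L -> F -> F).
Variables (sigma sigma' : F -> F) (tau : L -> L).
Hypotheses (sigmaD : {morph sigma : f g / f + g})
  (sigmaM : {morph sigma : f g / f * g}) (sigmaK : cancel sigma' sigma)
  (tauD : {morph tau : x y / x + y})
  (tauZ : forall f x, tau (smul f x) = smul (sigma' f) (tau x))
  (tau_br : {morph tau : x y / br x y})
  (act_sigma : forall x f, act x (sigma f) = sigma (act (tau x) f)).
Implicit Types (u v w : seq L -> F) (x : L) (s : seq L).

(** This becomes [phi_A^dagger] when [sigma] is the pullback of functions and [tau] is the inverse
    of [phi_A]. *)
Definition twist w : seq L -> F := fun s => sigma (w (map tau s)).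

Lemma contract_twist x w : contract x (twist w) = twist (contract (tau x) w).
Proof. by []. Qed.

Lemma sigma0 : sigma 0 = 0.
Proof. exact: (morph_add0 sigmaD). Qed.

Lemma sigmaN : {morph sigma : f / - f}.
Proof. exact: (morph_addN sigmaD). Qed.

Lemma parity_twist u : parity (twist u) = twist (parity u).
Proof.
apply: funext => s; rewrite /parity /twist size_map -signr_odd.
by case: odd; rewrite ?mul1r // !mulN1r sigmaN.
Qed.

Lemma is_form_twist w : is_form smul w -> is_form smul (twist w).
Proof.
move=> [wD wZ wA]; split=> s t *; rewrite /twist !map_cat /=.
- by rewrite tauD wD sigmaD.
- by rewrite tauZ wZ sigmaM sigmaK.
- by rewrite wA sigma0.
Qed.

Lemma twist_shuffle u v : twist (shuffle u v) = shuffle (twist u) (twist v).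
Proof.
apply: funext => s; elim: s u v => [|x s IH] u v; first exact: sigmaM.
by rewrite /twist /= sigmaD -!/(twist _ _) !IH parity_twist.
Qed.

Lemma lie_twist x w : lie br act x (twist w) = twist (lie br act (tau x) w).
Proof.
apply: funext => s; elim: s w => [|y s IH] w; first exact: act_sigma.
by rewrite /= contract_twist IH /twist /= tau_br sigmaD sigmaN.
Qed.

Lemma cediff_twist w : cediff br act (twist w) = twist (cediff br act w).
Proof.
apply: funext => s; elim: s w => [|x s IH] w; first exact/esym/sigma0.
by rewrite /= contract_twist IH lie_twist /twist /= sigmaD sigmaN.
Qed.

End Twist.

(** * Homogeneous forms *)

Section Degree.
Variables (F : comPzRingType) (L : zmodType).
Implicit Types (u v w : seq L -> F) (x : L) (s t : seq L) (k l : nat).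

Definition has_degree k w := forall s, size s != k -> w s = 0.

Lemma has_degree_parity k w : has_degree k w -> has_parity (odd k) w.
Proof. by move=> kw s sk; apply: kw; apply: contraNneq sk => ->. Qed.

Lemma has_degree_contract k x w : has_degree k.+1 w -> has_degree k (contract x w).
Proof. by move=> kw s sk; apply: kw. Qed.

Lemma has_degree0_contract x w : has_degree 0 w -> contract x w = 0.
Proof. by move=> kw; apply: funext => s; apply: kw. Qed.

Lemma shuffle0l v : shuffle 0 v = 0 :> (seq L -> F).
Proof. exact: (morph_add0 (fun u u' => shuffleDl u u' v)). Qed.

Lemma shuffle0r u : shuffle u 0 = 0 :> (seq L -> F).
Proof. exact: (morph_add0 (shuffleDr u)). Qed.

Lemma has_degree_shuffle k l u v :
  has_degree k u -> has_degree l v -> has_degree (k + l) (shuffle u v).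
Proof.
move=> ku lv s; elim: s k l u v ku lv => [|x s IH] k l u v ku lv /=.
  case: k ku => [|k] ku; last by rewrite ku // mul0r.
  by case: l lv => [//|l] lv; rewrite (lv [::]) // mulr0.
move=> sk; have pk : has_degree k (parity u) by move=> t tk; rewrite /parity ku ?mulr0.
have -> : shuffle (contract x u) v s = 0.
  case: k ku sk {pk} => [|k] ku sk; first by rewrite (has_degree0_contract _ ku) shuffle0l.
  exact: IH (has_degree_contract _ ku) lv _.
have -> : shuffle (parity u) (contract x v) s = 0; last by rewrite addr0.
case: l lv sk => [|l] lv sk; first by rewrite (has_degree0_contract _ lv) shuffle0r.
by apply: IH pk (has_degree_contract _ lv) _; move: sk; rewrite addnS.
Qed.

Variables (smul : F -> L -> L) (br : L -> L -> L) (act : L -> F -> F).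
Hypothesis LR : is_lie_rinehart smul br act.

Lemma lie_eq0 x w s : (forall t, size t = size s -> w t = 0) ->
  lie br act x w s = 0.
Proof.
elim: s w => [|y s IH] w w0 /=; first by rewrite w0 // (act0 LR).
by rewrite IH ?w0 ?subr0 // => t ts; apply: w0; rewrite /= ts.
Qed.

Lemma cediff_eq0 w s : (forall t, (size t).+1 = size s -> w t = 0) -> cediff br act w s = 0.
Proof.
elim: s w => [|x s IH] w w0 //=; rewrite lie_eq0 => [|t ts].
  by rewrite IH ?subr0 // => t ts; apply: w0; rewrite /= ts.
by apply: w0; rewrite ts.
Qed.

Lemma has_degree_cediff k w : has_degree k w -> has_degree k.+1 (cediff br act w).
Proof.
move=> kw s sk; apply: cediff_eq0 => t ts; apply: kw.
by apply: contraNneq sk => <-; rewrite ts.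
Qed.

End Degree.

(** * The exterior product as a signed sum over permutations *)

Section PermutationFormula.
Variables (F : comPzRingType) (L : zmodType) (smul : F -> L -> L).
Implicit Types (u v w : seq L -> F) (x : L) (s t : seq L) (k l m : nat).

Lemma form_front w s t x : is_form smul w ->
  w (s ++ x :: t) = (-1) ^+ size s * w (x :: s ++ t).
Proof.
elim/last_ind: s t => [|s y IH] t fw; first by rewrite mul1r.
rewrite cat_rcons (form_swap fw) IH // size_rcons exprS mulN1r mulNr cat_rcons.
by [].
Qed.

Definition permute m (s : seq L) (g : 'S_m) : seq L :=
  [seq nth 0 s (g i) | i <- enum 'I_m].

(** The lifted permutation sends [i] to 0, so the head of the list lands in position [i] and [g]
    arranges the rest around it. *)
Lemma permute_lift m x s (i : 'I_m.+1) (g : 'S_m) :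
  permute (x :: s) (lift_perm i ord0 g) =
    take i (permute s g) ++ x :: drop i (permute s g).
Proof.
have sp (h : 'S_m) : size (permute s h) = m by rewrite size_map size_enum_ord.
have im : (i <= m)%N by rewrite -ltnS.
apply: (@eq_from_nth _ 0).
  rewrite size_map size_enum_ord size_cat /= size_takel ?sp // size_drop sp.
  by rewrite addnS subnKC.
move=> p; rewrite size_map size_enum_ord => pm.
rewrite (nth_map ord0) ?size_enum_ord // -[p]/(val (Ordinal pm)) nth_ord_enum.
rewrite nth_cat size_takel ?sp //.
case: (unliftP i (Ordinal pm)) => [j -> | ->]; last first.
  by rewrite lift_perm_id ltnn subnn.
rewrite lift_perm_lift /= /bump; have jm := ltn_ord j.
case: (leqP i j) => ij /=.
  rewrite add1n ltnNge (leqW ij) /= subSn //= nth_drop subnKC //.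
  by rewrite (nth_map j) ?size_enum_ord // nth_ord_enum.
by rewrite add0n ij nth_take // (nth_map j) ?size_enum_ord // nth_ord_enum.
Qed.

(** Permutations are sorted by the preimage of 0. The parametrisation is injective, and bijective by
    the count [(m + 1) m! = (m + 1)!]. *)
Lemma sum_perm_lift m (V : nmodType) (f : 'S_m.+1 -> V) :
  \sum_(g : 'S_m.+1) f g =
  \sum_(i < m.+1) \sum_(g : 'S_m) f (lift_perm i ord0 g).
Proof.
pose h (p : 'I_m.+1 * 'S_m) := lift_perm p.1 ord0 p.2.
have hinj : injective h.
  move=> [i g] [i' g'] /= e.
  have ii : i = i'.
    apply: (@perm_inj _ (h (i, g))).
    by rewrite {2}e /h /= !lift_perm_id.
  rewrite -{}ii in e *; congr pair; apply/permP => j.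
  have /permP/(_ (lift i j)) := e.
  by rewrite /h /= !lift_perm_lift => /lift_inj.
rewrite pair_big /= (reindex h) //; apply: onW_bij; apply: inj_card_bij => //.
by rewrite card_prod !card_Sn card_ord factS.
Qed.

(** Used when the head is fed to the first factor of a product; [drop_insert] treats the second
    factor. *)
Lemma take_insert k (i : nat) x t : (i <= k)%N -> (k <= size t)%N ->
  take k.+1 (take i t ++ x :: drop i t) = take i (take k t) ++ x :: drop i (take k t) /\
  drop k.+1 (take i t ++ x :: drop i t) = drop k t.
Proof.
move=> ik kt; have szk : size (take k t) = k by rewrite size_takel.
have e : take i t ++ x :: drop i t =
    (take i (take k t) ++ x :: drop i (take k t)) ++ drop k t.
  rewrite -catA /= take_takel //; congr (_ ++ _ :: _).
  rewrite -{1}(cat_take_drop k t) drop_cat szk.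
  have [//|ki] := ltnP i k; have -> : i = k by apply/anti_leq/andP.
  by rewrite subnn drop0 (drop_oversize (s := take k t)) ?szk.
by rewrite e take_size_cat ?drop_size_cat // size_cat /= addnS -size_cat
  cat_take_drop szk.
Qed.

Lemma drop_insert k (i : nat) x t : (k <= i)%N -> (i <= size t)%N ->
  take k (take i t ++ x :: drop i t) = take k t /\
  drop k (take i t ++ x :: drop i t) =
    take (i - k) (drop k t) ++ x :: drop (i - k) (drop k t).
Proof.
move=> ki it; have kt := leq_trans ki it.
have e : take i t ++ x :: drop i t = take k t ++
    (take (i - k) (drop k t) ++ x :: drop (i - k) (drop k t)).
  rewrite drop_drop subnK // catA; congr (_ ++ _).
  by rewrite -takeD subnKC.
by rewrite e take_size_cat ?drop_size_cat ?size_takel.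
Qed.

(** Sorting by the position [i] of the head, the sum splits into [i < k], where [u] is contracted,
    and [k <= i], where [v] is contracted with sign [(-1) ^+ k]. These are the two terms of the
    recursion for [shuffle]. *)
Lemma perm_shuffle m k l u v s : is_form smul u -> is_form smul v ->
  has_degree k u -> has_degree l v -> m = (k + l)%N -> size s = m ->
  \sum_(g : 'S_m) (-1) ^+ g *
     (u (take k (permute s g)) * v (drop k (permute s g))) =
  (k`! * l`!)%:R * shuffle u v s.
Proof.
elim: m k l u v s => [|m IH] k l u v s fu fv ku lv mkl sm.
  case: s sm => // _; case: k l mkl {ku lv} => [|k] [|l] // _.
  rewrite (big_pred1 1%g) => [|g]; last by rewrite [g]permS0 /= eqxx.
  have -> : permute [::] (1 : 'S_0)%g = [::] by apply/size0nil; rewrite size_map size_enum_ord.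
  by rewrite odd_perm1 fact0 mul1n !mul1r.
case: s sm => // x s [sm]; rewrite sum_perm_lift /=.
have sp (h : 'S_m) : size (permute s h) = m by rewrite size_map size_enum_ord.
(* The sign of [lift_perm i ord0 g] cancels the cost of bringing the head to the front of its block,
   so a summand depends on [i] only through the block. *)
pose T (i : nat) := if (i < k)%N then
  \sum_(g : 'S_m) (-1) ^+ g *
     (contract x u (take k.-1 (permute s g)) * v (drop k.-1 (permute s g)))
  else (-1) ^+ k * \sum_(g : 'S_m) (-1) ^+ g *
     (u (take k (permute s g)) * contract x v (drop k (permute s g))).
transitivity (\sum_(i < m.+1) T i).
  apply: eq_bigr => i _; rewrite /T; case: ifP => ik.
    case: k ik mkl {ku T} => // k ik [mkl]; apply: eq_bigr => g _.
    rewrite permute_lift odd_lift_perm addbF.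
    have [|-> ->] := @take_insert k i x (permute s g) ik; first by rewrite sp mkl leq_addr.
    rewrite (form_front _ _ _ fu) size_takel; last first.
      by rewrite size_takel // sp mkl leq_addr.
    rewrite cat_take_drop signr_addb signr_odd /contract -!mulrA mulrCA.
    by rewrite signrMK.
  rewrite mulr_sumr; apply: eq_bigr => g _.
  have ki : (k <= i)%N by rewrite leqNgt ik.
  have im : (i <= size (permute s g))%N by rewrite sp -ltnS.
  rewrite permute_lift odd_lift_perm addbF.
  have [-> ->] := drop_insert x ki im.
  rewrite (form_front _ _ _ fv) size_takel; last by rewrite size_drop leq_sub2r.
  rewrite cat_take_drop signr_addb signr_odd -[in (-1) ^+ i](subnK ki) exprD.
  rewrite -[(-1) ^+ k]signr_odd -[(-1) ^+ (i - k)]signr_odd /contract -!mulrA.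
  by rewrite [u _ * _]mulrCA [(-1) ^+ g * _]mulrCA [X in _ * X = _]mulrCA signrMK.
rewrite -(big_mkord xpredT T) (@big_cat_nat _ _ _ k) //=; last by rewrite mkl leq_addr.
rewrite mulrDr; congr (_ + _).
  (* The [k] equal summands of the first block turn the factor [(k - 1)!] of the induction
     hypothesis into [k!]. *)
  rewrite (eq_big_nat _ _ (F2 := fun=> T 0)); last first.
    by move=> i /andP[_ ik]; rewrite /T ik (leq_ltn_trans _ ik).
  rewrite sumr_const_nat subn0 /T.
  case: k {T} ku mkl => [|k] ku [mkl].
    by rewrite (has_degree0_contract _ ku) shuffle0l [RHS]mulr0.
  rewrite (IH k l) //; [|exact: is_form_contract|exact: has_degree_contract].
  by rewrite ltn0Sn factS -mulnA [in RHS]natrM -[RHS]mulrA [RHS]mulr_natl.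

(* The second block has [l] equal summands. *)
rewrite (eq_big_nat _ _ (F2 := fun=> T k)); last first.
  by move=> i /andP[ki _]; rewrite /T ltnNge ki ltnn.
rewrite sumr_const_nat /T ltnn mkl addKn.
rewrite (has_parityE (has_degree_parity ku)) signr_odd shuffleZl /scale_form.
case: l {T} lv mkl => [|l] lv mkl.
  by rewrite (has_degree0_contract _ lv) shuffle0r !mulr0.
move: mkl; rewrite addnS => -[mkl].
rewrite (IH k l) //; [|exact: is_form_contract|exact: has_degree_contract].
rewrite factS mulnCA natrM -mulr_natl.
ring.
Qed.

End PermutationFormula.

(** * Bump functions and tensorial operators *)

Section FlatFunction.
Local Open Scope classical_set_scope.
Variable R : realType.
Implicit Types (t : R) (m k n : nat).

(* The functions t^-m exp(-1/t), extended by 0; the span of this family is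
   stable under differentiation. *)
Definition flat m t : R := if 0 < t then t^-1 ^+ m * expR (- t^-1) else 0.

Lemma flat_ge0 m t : 0 <= flat m t.
Proof.
rewrite /flat; case: ifPn => // t0.
by rewrite mulr_ge0 ?expR_ge0 // exprn_ge0 // invr_ge0 ltW.
Qed.

Lemma flat_gt0 m t : 0 < t -> 0 < flat m t.
Proof. by move=> t0; rewrite /flat t0 mulr_gt0 ?expR_gt0 // exprn_gt0 // invr_gt0. Qed.

Lemma flat_le0 m t : t <= 0 -> flat m t = 0.
Proof. by move=> t0; rewrite /flat ltNge t0. Qed.

(** For [t > 0], keep one term of the exponential series: [exp (1/t) >= t^-(m+1) / (m+1)!]. *)
Lemma flat_le_norm m t : flat m t <= m.+1`!%:R * `|t|.
Proof.
have [t0|t0] := ltP 0 t; last first.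
  by rewrite flat_le0 // mulr_ge0 // ler0n.
rewrite /flat t0 gtr0_norm // expRN ler_pdivrMr ?expR_gt0 //.
have := expR_ge1Dxn m (ltW (_ : 0 < t^-1)); rewrite invr_gt0 => /(_ t0) e.
have : t^-1 ^+ m.+1 / m.+1`!%:R <= expR t^-1 by apply: le_trans e; rewrite lerDr.
rewrite ler_pdivrMr ?ltr0n ?fact_gt0 // => {}e.
rewrite -(ler_pM2l (_ : 0 < t^-1)) ?invr_gt0 // -exprS (le_trans e) //.
by rewrite [m.+1`!%:R * t]mulrC !mulrA mulVf ?gt_eqF // mul1r mulrC.
Qed.

Lemma is_derive_flat m t :
  is_derive t 1 (flat m) (flat m.+2 t - m%:R * flat m.+1 t).
Proof.
have [t0|t0|->] := ltgtP t 0.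
- rewrite !flat_le0 ?ltW // mulr0 subr0.
  apply: near_eq_is_derive (is_derive_cst (0 : R) t 1).
  near=> y; rewrite flat_le0 //; near: y.
  by apply: filterS (lt_nbhsl t0) => y /ltW.
- pose s := fun y : R => y^-1.
  have ds : is_derive t 1 s (- t^-1 ^+ 2).
    have dv : derivable s t 1 by apply: derivableV; rewrite ?gt_eqF.
    apply: DeriveDef => //; rewrite /s deriveV ?gt_eqF //.
    by rewrite derive_id exprVn; apply: mulr1.
  have dm : is_derive t 1 (s ^+ m * (expR \o (- s)))
      (flat m.+2 t - m%:R * flat m.+1 t).
    apply: is_derive_eq; rewrite /flat t0 !fctE /s.
    rewrite /GRing.scale /=; case: m => [|m]; last by rewrite !exprS /=; ring.
    by rewrite expr0 !mul0r; ring.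
  apply: near_eq_is_derive dm; near=> y.
  rewrite /flat ifT ?fctE //; near: y; exact: lt_nbhsr.
- rewrite !flat_le0 // mulr0 subr0.
  have lim : h^-1 *: (flat m (h *: 1 + 0) - flat m 0) @[h --> 0^'] --> (0 : R).
    apply/cvgr0Pnorm_lt => e e0; near=> h.
    rewrite [h *: 1](mulr1 h) addr0 (flat_le0 _ (lexx 0)) subr0.
    (* The difference quotient at 0 is the next function of the family, which tends to 0 by
       [flat_le_norm]. *)
    have hm : h^-1 *: flat m h = flat m.+1 h.
      rewrite /flat; case: ifP => _; last exact: mulr0.
      by rewrite exprS -mulrA.
    rewrite hm ger0_norm ?flat_ge0 // (le_lt_trans (flat_le_norm _ _)) //.
    rewrite -ltr_pdivlMl ?ltr0n ?fact_gt0 //; near: h.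
    apply: dnbhs0_lt; rewrite mulr_gt0 // invr_gt0 ltr0n fact_gt0 //.
  by apply: DeriveDef; [apply/cvg_ex; exists 0|apply: cvg_lim].
Unshelve. all: by end_near. Qed.

End FlatFunction.

Section BumpFunction.
Local Open Scope classical_set_scope.
Variable R : realType.

(** Differentiation raises the index of [flat], so the induction on [k] is over all [m] at once. *)
Lemma Ck_flat n k m (f : 'rV[R]_n -> R) x :
  Ck k f x -> Ck k (fun y => flat m (f y)) x.
Proof.
have dflat j (t : R) : differentiable (flat j) t.
  by apply/derivable1_diffP; case: (is_derive_flat j t).
elim: k m f => [|k IH] m f Cf.
  by apply: continuous_comp => //; exact: differentiable_continuous.
have [df Df] := Cf; split.
  by apply: filterS df => y dfy; apply: differentiable_comp.
move=> v; apply: (@Ck_ext _ _ _ (fun y => 'D_v f y *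
    (flat m.+2 (f y) + - m%:R * flat m.+1 (f y)))).
  apply: filterS df => y dfy.
  rewrite [RHS]deriveE; last exact: differentiable_comp.
  rewrite (diff_comp dfy (dflat m (f y))) /= deriveE // deriv1E; last first.
    by case: (is_derive_flat m (f y)).
  by rewrite derive1E (@derive_val _ _ _ _ _ _ _ (is_derive_flat m (f y))) mulNr.
apply: CkM (Df v) _; apply: CkD; first exact/IH/CkS.
by apply: CkM; [exact: Ck_cst|exact/IH/CkS].
Qed.

Lemma Ck_inv n k (f : 'rV[R]_n -> R) x :
  f x != 0 -> Ck k f x -> Ck k (fun y => (f y)^-1) x.
Proof.
elim: k f => [|k IH] f f0 Cf; first exact: continuousV.
have [df Df] := Cf.
have fN0 : \forall y \near x, f y != 0.
  have cf : {for x, continuous f}.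
    by apply: differentiable_continuous; exact: nbhs_singleton df.
  by apply: (cf [set t | t != 0]); apply: open_nbhs_nbhs; split => //; exact: open_neq.
split; first by apply: filterS2 df fN0 => y; exact: differentiableV.
move=> v; apply: (@Ck_ext _ _ _ (fun y =>
    (- 1) * ((f y)^-1 * (f y)^-1) * 'D_v f y)).
  apply: filterS2 df fN0 => y dfy fy0.
  rewrite deriveV //; last exact: diff_derivable.
  by rewrite -exprVn expr2 mulN1r.
apply: CkM (Df v); apply: CkM; first exact: Ck_cst.
by apply: CkM; exact/IH/CkS.
Qed.

Lemma Ck_coord n k (i : 'I_n) (x : 'rV[R]_n) : Ck k (fun y : 'rV[R]_n => y 0 i) x.
Proof.
case: k => [|k]; first exact: coord_continuous.
split; first by apply: (@nearW _ (nbhs x)) => y; exact: differentiable_coord.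
move=> v; apply: (@Ck_ext _ _ _ (fun=> v 0 i)); last exact: Ck_cst.
apply: (@nearW _ (nbhs x)) => y.
by rewrite -(derive_coord (g := id)) ?derive_id.
Qed.

Variables (n : nat) (M : manifold R n).

Lemma smoothV (f : M -> R) p :
  f p != 0 -> smooth_fun_at f p -> smooth_fun_at (fun q => (f q)^-1) p.
Proof.
move=> f0 sf c ac cp k; apply: Ck_inv (sf c ac cp k).
by rewrite /= (cmapK cp).
Qed.

Lemma smooth_cmap (c : chart R n M) (h : 'rV[R]_n -> R) p :
  atlas c -> cdom c p -> smooth_at h (cmap c p) ->
  smooth_fun_at (fun q => h (cmap c q)) p.
Proof.
move=> ac cp sh c0 ac0 c0p k; apply: (@Ck_comp _ _ _ _ h) => [i|].
  exact: atlas_compat.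
by rewrite (cmapK c0p).
Qed.

(** The closed set [K] is what makes extensions by zero smooth: its complement is an open set on
    which [b] vanishes. *)
Lemma bump_function (p : M) (U : set M) : nbhs p U ->
  exists b : smooth_fun M, b p != 0 /\
  exists K : set M, [/\ closed K, K `<=` U & forall q, ~ K q -> b q = 0].
Proof.
move=> Up; have [c ac cp] := atlas_cover p.
set u0 := cmap c p.
have cdn q : cdom c q -> nbhs q (cdom c).
  by move=> cq; apply: open_nbhs_nbhs; split => //; exact: cdom_open.
(* The closed ball lies in the image of the chart, and [cinv c] carries it into [U] and the chart
   domain. *)
have /nbhs_closedballP[e eV] : nbhs u0
    (cmap c @` cdom c `&` (cinv c @^-1` (U `&` cdom c))).
  apply: filterI.
    by apply: open_nbhs_nbhs; split; [exact: cimg_open|exists p].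
  apply: (cinv_continuous cp); rewrite (cmapK cp).
  exact: filterI Up (cdn _ cp).
set B := closed_ball u0 e%:num in eV.
have BE : B = closed_ball_ Num.norm u0 e%:num by exact: closed_ballE.
(* [e^2 - |u - u0|^2] for the Euclidean norm, a polynomial in the coordinates; where it is positive,
   [u] lies in the sup-norm ball [B]. *)
pose rho (u : 'rV[R]_n) : R := e%:num ^+ 2 +
  \sum_(i < n) (-1) * ((u 0 i + - u0 0 i) * (u 0 i + - u0 0 i)).
have rhoB u : 0 < rho u -> B u.
  rewrite BE /closed_ball_ /= => rho0.
  rewrite [leLHS]/Num.norm /= mx_normrE; apply/bigmax_leP; split => //= -[i j] _.
  rewrite (ord1 i) !mxE leNgt; apply: contraTN rho0 => ej; rewrite -leNgt /rho.
  rewrite (bigD1 j) //= addrA -[leRHS]addr0 lerD //; last first.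
    apply: sumr_le0 => k _; rewrite mulN1r oppr_le0.
    by rewrite -expr2 sqr_ge0.
  rewrite mulN1r subr_le0 -expr2 -[leRHS]real_normK ?num_real // distrC.
  by rewrite ler_sqr ?nnegrE // ltW.
pose K := cinv c @` B.
have KU q : K q -> U q /\ cdom c q.
  by move=> [u /eV[_ [Uu cu]] <-].
(* [K] is a continuous image of a compact ball, and compact subsets of a Hausdorff space are
   closed. *)
have clK : closed K.
  apply: compact_closed; first exact: manifold_hausdorff.
  apply: continuous_compact.
    apply: continuous_in_subspaceT => u /set_mem/eV[[q cq <-] _].
    exact: cinv_continuous.
  apply: bounded_closed_compact; last exact: closed_ball_closed.
  exists (`|u0| + e%:num); split; first exact: num_real.
  move=> a ltea u; rewrite BE /closed_ball_ /= => ue; apply: le_trans (ltW ltea).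
  have -> : u = u0 - (u0 - u) by rewrite opprB addrC subrK.
  by rewrite (le_trans (ler_normB _ _)) // lerD2l.
pose b q := if `[< cdom c q >] then flat 0 (rho (cmap c q)) else 0.
have b0 q : ~ K q -> b q = 0.
  rewrite /b; case: asboolP => // cq; apply: contra_notP => /eqP bq.
  exists (cmap c q); last exact: cmapK.
  apply: rhoB; rewrite ltNge; apply: contraNN bq => le0.
  by rewrite flat_le0.
have bs q : smooth_fun_at b q.
  have [cq|cq] := pselect (cdom c q).
    apply: (@smooth_fun_ext _ _ _ (fun q => flat 0 (rho (cmap c q)))).
      by apply: filterS (cdn _ cq) => q' cq'; rewrite /b asboolT.
    apply: (smooth_cmap (h := fun u => flat 0 (rho u)) ac cq) => k; apply: Ck_flat.
    apply: CkD; first exact: Ck_cst.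
    apply: Ck_sum => i _; apply: CkM; first exact: Ck_cst.
    by apply: CkM; apply: CkD; [exact: Ck_coord|exact: Ck_cst|exact: Ck_coord|exact: Ck_cst].
  apply: (@smooth_fun_ext _ _ _ (fun=> 0)); last exact: smooth_cst.
  have : nbhs q (~` K).
    by apply: open_nbhs_nbhs; split; [exact: closed_openC|move=> /KU[]].
  by apply: filterS => q' Kq'; rewrite b0.
exists (SmoothFun bs); split.
  rewrite /= /b asboolT // gt_eqF // flat_gt0 // /rho big1 ?addr0 ?exprn_gt0 //.
  by move=> i _; rewrite subrr mul0r mulr0.
by exists K; split => // q /KU[].
Qed.

End BumpFunction.

(** * Finite families of arguments as lists *)

Definition arg_seq (T : Type) k (x : 'I_k -> T) : seq T := [seq x i | i <- enum 'I_k].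

Lemma size_arg_seq (T : Type) k (x : 'I_k -> T) : size (arg_seq x) = k.
Proof. by rewrite size_map size_enum_ord. Qed.

Lemma nth_arg_seq (T : Type) k (x : 'I_k -> T) d (i : 'I_k) : nth d (arg_seq x) i = x i.
Proof. by rewrite (nth_map i) ?size_enum_ord // nth_ord_enum. Qed.

Lemma map_arg_seq (T U : Type) (f : T -> U) k (x : 'I_k -> T) :
  map f (arg_seq x) = arg_seq (f \o x).
Proof. by rewrite /arg_seq -map_comp. Qed.

Lemma arg_seqP (T : Type) k (x : 'I_k -> T) d (s : seq T) :
  size s = k -> (forall i : 'I_k, nth d s i = x i) -> s = arg_seq x.
Proof.
move=> sk sx; apply: (@eq_from_nth _ d); first by rewrite size_arg_seq.
move=> i; rewrite sk => ik; rewrite -[i]/(val (Ordinal ik)) nth_arg_seq.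
exact: sx.
Qed.

Section SeqFormLemmas.
Variables (F : comPzRingType) (L : zmodType) (smul : F -> L -> L).
Implicit Types (w : seq L -> F) (x y : L) (s t : seq L) (f : F).

Lemma form_sum w s t (I : Type) (r : seq I) (x : I -> L) : is_form smul w ->
  w (s ++ (\sum_(i <- r) x i) :: t) = \sum_(i <- r) w (s ++ x i :: t).
Proof.
move=> fw; elim: r => [|i r IH]; first by rewrite !big_nil (form0 fw).
by rewrite !big_cons (formD fw) IH.
Qed.

Lemma form_map_smul w s t f : is_form smul w ->
  w (s ++ map (smul f) t) = f ^+ size t * w (s ++ t).
Proof.
move=> fw; elim: t s => [|x t IH] s; first by rewrite mul1r.
by rewrite /= (formZ fw) -cat_rcons IH cat_rcons exprS mulrA.
Qed.

(** Adjacent swaps carry the first copy of [x] up to the second. *)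
Lemma form_repeat w s s' t x : is_form smul w -> w (s ++ x :: s' ++ x :: t) = 0.
Proof.
move=> fw; elim: s' s => [|y s' IH] s; first exact: (form_alt fw).
by rewrite /= (form_swap fw) -(cat_rcons y) IH oppr0.
Qed.

Lemma form_nth_eq w s (i j : nat) : is_form smul w -> (i < j < size s)%N ->
  nth 0 s i = nth 0 s j -> w s = 0.
Proof.
move=> fw /andP[ij js] e; have is_ := ltn_trans ij js.
have -> : s = take i s ++ nth 0 s i ::
    take (j - i.+1) (drop i.+1 s) ++ nth 0 s i :: drop j.+1 s.
  rewrite {2}e -(drop_nth 0 js).
  have <- : drop (j - i.+1) (drop i.+1 s) = drop j s by rewrite drop_drop subnK.
  by rewrite cat_take_drop -(drop_nth 0 is_) cat_take_drop.
exact: form_repeat.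
Qed.

End SeqFormLemmas.

(** * Extension of local data to global sections *)

Section Sections.
Local Open Scope classical_set_scope.
Variables (R : realType) (n : nat) (M : manifold R n) (r : nat).
Variable A : vbundle M r.
Implicit Types (x y : sect A) (s t : seq (sect A)) (p q : M).

Lemma smooth_fun_neq0 (f : smooth_fun M) p : f p != 0 -> \forall q \near p, f q != 0.
Proof.
move=> f0; have [c ac cp] := atlas_cover p.
have cf : (f \o cinv c) @ cmap c p --> f (cinv c (cmap c p)) := sfun_smooth f ac cp 0.
rewrite (cmapK cp) in cf.
have N0 : nbhs (f p) [set t | t != 0].
  by apply: open_nbhs_nbhs; split => //; exact: open_neq.
have : \forall u \near cmap c p, f (cinv c u) != 0.
  exact: cf N0.
move=> /(cmap_continuous cp) cN.
have cd : nbhs p (cdom c) by apply: open_nbhs_nbhs; split => //; exact: cdom_open.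
by apply: filterS2 cd cN => q cq /=; rewrite (cmapK cq).
Qed.

Lemma smooth_fun_sumE (I : Type) (u : seq I) (f : I -> smooth_fun M) p :
  (\sum_(i <- u) f i) p = \sum_(i <- u) f i p.
Proof. by elim: u => [|i u IH]; rewrite ?big_nil // !big_cons -IH. Qed.

Lemma smooth_fun_exprE (f : smooth_fun M) k p : (f ^+ k) p = f p ^+ k.
Proof. by elim: k => [//|k IH]; rewrite !exprS -IH. Qed.

Lemma sect_sumE (I : Type) (u : seq I) (x : I -> sect A) p :
  (\sum_(i <- u) x i) p = \sum_(i <- u) x i p.
Proof. by elim: u => [|i u IH]; rewrite ?big_nil // !big_cons -IH. Qed.

(** Two factors [b] are needed: one makes the frame global, the other the coefficients of [x]. The
    decomposition of [b * b] times [x] then holds on all of [M]. *)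
Lemma frame_cutoff (tr : triv r A) p : batlas tr -> tdom tr p ->
  exists (b : smooth_fun M) (e : 'I_r -> sect A),
  [/\ b p != 0, forall j q, e j q = b q *: frame tr j q &
    forall x, exists c : 'I_r -> smooth_fun M,
      (forall j q, c j q = b q * tfun tr q (x q) 0 j) /\
      sect_mul (b * b) x = \sum_(j < r) sect_mul (c j) (e j)].
Proof.
move=> bt tp.
have tn q : tdom tr q -> nbhs q (tdom tr).
  by move=> tq; apply: open_nbhs_nbhs; split => //; exact: tdom_open.
have [b [bp [K [clK KU b0]]]] := bump_function (tn p tp).
have near0 q : ~ tdom tr q -> \forall q' \near q, b q' = 0.
  move=> tq; have : nbhs q (~` K).
    by apply: open_nbhs_nbhs; split; [exact: closed_openC|move=> /KU].
  by apply: filterS.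
have es j q : smooth_sect_at (fun q => b q *: frame tr j q) q.
  move=> tr' i bt' tq'; have [tq|tq] := pselect (tdom tr q).
    apply: (@smooth_fun_ext _ _ _ (fun q => b q * tfun tr' q (frame tr j q) 0 i)).
      by apply: nearW => q'; rewrite linearZ mxE.
    by apply: smoothM; [exact: sfun_smooth|exact: batlas_compat].
  apply: (@smooth_fun_ext _ _ _ (fun=> 0)); last exact: smooth_cst.
  by apply: filterS (near0 _ tq) => q' ->; rewrite scale0r linear0 mxE.
have cs x j q : smooth_fun_at (fun q => b q * tfun tr q (x q) 0 j) q.
  have [tq|tq] := pselect (tdom tr q).
    by apply: smoothM; [exact: sfun_smooth|apply: sect_smooth].
  apply: (@smooth_fun_ext _ _ _ (fun=> 0)); last exact: smooth_cst.
  by apply: filterS (near0 _ tq) => q' ->; rewrite mul0r.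
exists b, (fun j => Sect (es j)); split => // x.
exists (fun j => SmoothFun (cs x j)); split => //.
apply: sect_eq => q; rewrite sect_sumE /=.
(* Inside [K] the frame decomposition is available; outside, [b] vanishes and so do both sides. *)
have [Kq|Kq] := pselect (K q); last first.
  by rewrite (b0 _ Kq) mul0r scale0r big1 // => j _; rewrite mul0r scale0r.
rewrite {1}(frame_decomp (x q) (KU _ Kq)) scaler_sumr.
by apply: eq_bigr => j _; rewrite !scalerA mulrAC.
Qed.

(** Dividing the coordinates of [v] by the constant [b p] undoes the cut-off at [p]. *)
Lemma sect_extend p (v : A p) : exists x : sect A, x p = v.
Proof.
have [tr bt tp] := batlas_cover A p.
have [b [e [bp eE _]]] := frame_cutoff bt tp.
exists (\sum_(j < r) sect_mul (sf_cst M (tfun tr p v 0 j / b p)) (e j)).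
rewrite sect_sumE [RHS](frame_decomp v tp); apply: eq_bigr => j _ /=.
by rewrite eE scalerA divfK.
Qed.

End Sections.

Section LocalOperators.
Variables (R : realType) (n : nat) (M : manifold R n) (r : nat).
Variables (A : vbundle M r) (w : seq (sect A) -> smooth_fun M).
Hypothesis fw : is_form (@sect_mul R n M r A) w.
Implicit Types (x y : sect A) (s t : seq (sect A)) (p q : M).

(** By linearity [b * b] times the value is a combination with coefficients [c j], which vanish at
    [p] together with [x]; then divide by [b p * b p]. *)
Lemma form_local0 s t x p : x p = 0 -> w (s ++ x :: t) p = 0.
Proof.
move=> x0; have [tr bt tp] := batlas_cover A p.
have [b [e [bp eE /(_ x)[c [cE bbx]]]]] := frame_cutoff bt tp.
have /(congr1 (fun f : smooth_fun M => f p)) := formZ fw s t (b * b) x.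
rewrite bbx (form_sum _ _ _ _ fw) smooth_fun_sumE big1 => [|j _]; last first.
  rewrite (formZ fw) -[LHS]/(c j p * w (s ++ e j :: t) p) cE x0 linear0 mxE.
  by rewrite mulr0 mul0r.
rewrite -[RHS in _ = RHS -> _]/((b p * b p) * w (s ++ x :: t) p).
by move/esym/eqP; rewrite !mulf_eq0 (negPf bp) /= => /eqP.
Qed.

Lemma form_local s t x y p : x p = y p -> w (s ++ x :: t) p = w (s ++ y :: t) p.
Proof.
move=> xy; have xy0 : (x - y) p = 0.
  by rewrite -[LHS]/(x p + (-1) *: y p) scaleN1r xy subrr.
rewrite -[x](subrK y) (formD fw).
rewrite -[LHS]/(w (s ++ (x - y) :: t) p + w (s ++ y :: t) p).
by rewrite (form_local0 _ _ xy0) add0r.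
Qed.

Lemma form_local_seq s t t' p : size t = size t' ->
  (forall i, nth 0 t i p = nth 0 t' i p) -> w (s ++ t) p = w (s ++ t') p.
Proof.
elim: t t' s => [|x t IH] [|y t'] s //= [st] tt'.
rewrite (form_local s t (tt' 0)) /= -!(cat_rcons y) (IH t') // => i.
exact: (tt' i.+1).
Qed.

(** The tensoriality lemma. Vectors at [p] are extended to arbitrary global sections, and by
    [form_local_seq] the value at [p] does not depend on the extensions. *)
Lemma form_of_seq k : exists z : bform A k,
  forall x : 'I_k -> sect A, form_eval z x = w (arg_seq x).
Proof.
have [ext extE] : {ext : forall p, A p -> sect A | forall p v, ext p v p = v}.
  exists (fun p v => projT1 (cid (sect_extend v))) => p v.
  exact: projT2 (cid (sect_extend v)).
pose z p (v : 'I_k -> A p) := w (arg_seq (fun i => ext p (v i))) p.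
have zE p (x : 'I_k -> sect A) : z p (fun i => x i p) = w (arg_seq x) p.
  apply: (form_local_seq [::]); first by rewrite !size_arg_seq.
  move=> i; have [ik|ki] := ltnP i k; last by rewrite !nth_default // size_arg_seq.
  by rewrite -[i]/(val (Ordinal ik)) !nth_arg_seq extE.
have z_upd p v i u : z p (upd v i u) = w (take i (arg_seq (ext p \o v)) ++
    ext p u :: drop i.+1 (arg_seq (ext p \o v))) p.
  have sv := size_arg_seq (ext p \o v); have ik := ltnW (ltn_ord i).
  rewrite /z; congr (w _ p); symmetry; apply: (arg_seqP (d := 0)).
    rewrite size_cat /= size_takel ?sv //.
    by rewrite size_drop sv addnS -addSn subnKC.
  move=> j; rewrite nth_cat size_takel ?sv // /upd.
  have [->|ji] := eqVneq j i; first by rewrite ltnn subnn.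
  move: ji; rewrite neq_ltn => /orP[ji|ij].
    by rewrite ji nth_take // nth_arg_seq.
  by rewrite ltnNge ltnW //= -subnSK //= nth_drop subnKC // nth_arg_seq.
have zm p : multilinear (z p).
  move=> i v a u u'; rewrite !z_upd.
  (* [ext p] need not be linear, but the two sections agree at [p]. *)
  rewrite (@form_local _ _ _ (sect_mul (sf_cst M a) (ext p u) + ext p u')); last first.
    by rewrite extE /= !extE.
  by rewrite (formD fw) (formZ fw).
have za p : alternating (z p).
  move=> v i j ij vij; rewrite /z.
  have H (i' j' : 'I_k) : (i' < j')%N -> v i' = v j' ->
      w (arg_seq (fun i => ext p (v i))) p = 0.
    move=> lij e; rewrite (form_nth_eq (i := i') (j := j') fw) //.
      by rewrite lij size_arg_seq /=.
    by rewrite !nth_arg_seq e.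
  move: ij; rewrite neq_ltn => /orP[] lij; first exact: H lij vij.
  exact: H lij (esym vij).
have zs p tr (J : 'I_k -> 'I_r) : batlas tr -> tdom tr p ->
    smooth_fun_at (fun q => z q (fun i => frame tr (J i) q)) p.
  move=> bt tp; have [b [e [bp eE _]]] := frame_cutoff bt tp.
  have bk : (b ^+ k) p != 0 by rewrite smooth_fun_exprE expf_neq0.
  (* Where [b] is nonzero a frame vector is [e j] divided by [b], so the component is a quotient of
     smooth functions. *)
  apply: (@smooth_fun_ext _ _ _ (fun q => w (arg_seq (e \o J)) q * ((b ^+ k) q)^-1)).
    apply: filterS (smooth_fun_neq0 bp) => q bq; rewrite -zE.
    pose s := arg_seq (fun i => ext q (frame tr (J i) q)).
    (* The scalar is frozen at [b q]: the sections need only agree at the point [q]. *)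
    have -> : z q (fun i => (e \o J) i q) = w (map (sect_mul (sf_cst M (b q))) s) q.
      rewrite zE map_arg_seq; apply: (form_local_seq [::]).
        by rewrite !size_arg_seq.
      move=> i; have [ik|ki] := ltnP i k; last by rewrite !nth_default // size_arg_seq.
      by rewrite -[i]/(val (Ordinal ik)) !nth_arg_seq /= eE extE.
    rewrite -[map _ s]cat0s (form_map_smul _ _ _ fw) size_arg_seq.
    rewrite -[LHS]/(((sf_cst M (b q)) ^+ k) q * _ / _) !smooth_fun_exprE /=.
    by rewrite mulrAC divff ?mul1r // expf_neq0.
  apply: smoothM; first exact: sfun_smooth.
  by apply: smoothV => //; exact: sfun_smooth.
exists (Form zm za zs) => x; apply: smooth_fun_eq => p; exact: zE.
Qed.

End LocalOperators.

(** * Embedding of differential forms into functions of lists *)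

Section FormsAsSeqForms.
Variables (R : realType) (n : nat) (M : manifold R n) (r : nat).
Variable A : vbundle M r.
Implicit Types (k l : nat) (s : seq (sect A)).

Local Notation smul := (@sect_mul R n M r A).

(** Extension by 0 to other lengths puts all degrees into one type, where transport along equalities
    of degrees is invisible ([form_seq_gcast]). *)
Definition form_seq k (w : bform A k) : seq (sect A) -> smooth_fun M :=
  fun s => if size s == k then form_eval w (fun i => nth 0 s i) else 0.

Lemma form_seqE k (w : bform A k) (x : 'I_k -> sect A) :
  form_seq w (arg_seq x) = form_eval w x.
Proof.
rewrite /form_seq size_arg_seq eqxx; congr form_eval.
by apply: funext => i; rewrite nth_arg_seq.
Qed.

Lemma form_seq_degree k (w : bform A k) : has_degree k (form_seq w).
Proof. by move=> s /negPf; rewrite /form_seq => ->. Qed.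

(** Any vectors at a point extend to global sections. Identities between forms are proved below
    through this embedding. *)
Lemma form_seq_inj k : injective (@form_seq k).
Proof.
move=> w z wz; apply: form_eq => p v.
have [x xE] := choice (fun i => sect_extend (v i)).
have -> : v = (fun i => x i p) by apply: funext => i; rewrite xE.
have := congr1 (fun f => f (arg_seq x)) wz.
by rewrite !form_seqE => /(congr1 (fun f : smooth_fun M => f p)).
Qed.

Lemma is_form_form_seq k (w : bform A k) : is_form smul (form_seq w).
Proof.
(* The entry 0 is a placeholder that [upd] overwrites. *)
have updE p s t (u : sect A) (sk : (size s < k)%N) :
    (fun i : 'I_k => nth 0 (s ++ u :: t) i p) =
    upd (fun i : 'I_k => nth 0 (s ++ 0 :: t) i p) (Ordinal sk) (u p).
  apply: funext => i; rewrite /upd -val_eqE /= !nth_cat.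
  case: ltngtP => //= [si|->]; last by rewrite subnn.
  by rewrite -subnSK.
have upd_lin p v i (a : R) (u u' : A p) := form_multilinear w i v a u u'.
split=> s t; rewrite /form_seq.
- move=> x y; rewrite !size_cat /=; case: eqP => [sk|_]; last by rewrite addr0.
  have {}sk : (size s < k)%N by rewrite -sk addnS ltnS leq_addr.
  apply: smooth_fun_eq => p /=; rewrite (updE p s t (x + y)).
  rewrite (updE p s t x) (updE p s t y) -[(x + y) p]/(x p + y p).
  by rewrite -{1}[x p]scale1r upd_lin mul1r.
- move=> f x; rewrite !size_cat /=; case: eqP => [sk|_]; last by rewrite mulr0.
  have {}sk : (size s < k)%N by rewrite -sk addnS ltnS leq_addr.
  apply: smooth_fun_eq => p /=; rewrite (updE p s t (smul f x)) (updE p s t x) /=.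
  rewrite -[f p *: x p]addr0 upd_lin -[RHS]addr0; congr (_ + _).
  (* With coefficient -1 and zero vectors, multilinearity says that the form vanishes when a slot is
     0. *)
  have := upd_lin p (fun i => nth 0 (s ++ 0 :: t) i p) (Ordinal sk) (- 1) 0 0.
  by rewrite scaler0 addr0 mulN1r addNr.
- move=> x; rewrite size_cat /=; case: eqP => // sk; apply: smooth_fun_eq => p /=.
  have sk1 : (size s < k)%N by rewrite -sk addnS ltnS leq_addr.
  have sk2 : ((size s).+1 < k)%N by rewrite -sk !addnS !ltnS leq_addr.
  apply: (@form_alternating _ _ _ _ _ _ w p _ (Ordinal sk1) (Ordinal sk2)).
    by rewrite -val_eqE /= neq_ltn ltnSn.
  by rewrite /= !nth_cat ltnn subnn ltnNge leqnSn subSnn.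
Qed.

Lemma form_seqD k (w z : bform A k) : form_seq (w + z) = form_seq w + form_seq z.
Proof.
apply: funext => s; rewrite /form_seq !fctE; case: eqP => _; last by rewrite addr0.
exact: smooth_fun_eq.
Qed.

Lemma form_seqZ k (a : R) (w : bform A k) :
  form_seq (a *: w) = scale_form (sf_cst M a) (form_seq w).
Proof.
apply: funext => s; rewrite /form_seq /scale_form; case: eqP => _; last by rewrite mulr0.
exact: smooth_fun_eq.
Qed.

Lemma form_seq0 k : form_seq (0 : bform A k) = 0.
Proof.
apply: funext => s; rewrite /form_seq; case: eqP => // _.
exact: smooth_fun_eq.
Qed.

Lemma form_seq_gcast k l (e : k = l) (w : bform A k) :
  form_seq (gcast (C := bform A) e w) = form_seq w.
Proof. by case: l / e. Qed.

Lemma form_seq_one : form_seq (form_one A) = zero_form 1.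
Proof.
apply: funext => -[|x s]; rewrite /form_seq //=.
exact: smooth_fun_eq.
Qed.

(** [perm_shuffle] gives the identity multiplied by [k! l!]; this factor is cancelled after
    evaluation at a point, where it is a nonzero real. *)
Lemma form_seq_wedge k l (w : bform A k) (z : bform A l) :
  form_seq (wedge w z) = shuffle (form_seq w) (form_seq z).
Proof.
have wk := form_seq_degree w; have zl := form_seq_degree z.
apply: funext => s; have [sk|sk] := eqVneq (size s) (k + l)%N; last first.
  by rewrite (has_degree_shuffle wk zl) // form_seq_degree.
have := perm_shuffle (is_form_form_seq w) (is_form_form_seq z) wk zl erefl sk.
move=> E; apply: smooth_fun_eq => p; move/(congr1 (fun f : smooth_fun M => f p)): E.
have pg (g : 'S_(k + l)) : size (permute s g) = (k + l)%N.
  by rewrite size_map size_enum_ord.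
have nth_pg (g : 'S_(k + l)) (i : 'I_(k + l)) : nth 0 (permute s g) i = nth 0 s (g i).
  by rewrite (nth_map i) ?size_enum_ord // nth_ord_enum.
have mulE (f g : smooth_fun M) : (f * g) p = f p * g p by [].
have natE m : (m%:R : smooth_fun M) p = m%:R.
  by elim: m => [//|m IH]; rewrite !mulrS -IH.
rewrite smooth_fun_sumE mulE natE => E; rewrite /form_seq sk eqxx.
have kl0 : (k`! * l`!)%:R != 0 :> R by rewrite pnatr_eq0 -lt0n muln_gt0 !fact_gt0.
apply: (mulfI kl0); rewrite -{}E /= /alt_wedge mulVKf //; apply: eq_bigr => g _.
have -> : take k (permute s g) = arg_seq (fun i => nth 0 s (g (lshift l i))).
  apply: (arg_seqP (d := 0)) => [|i]; first by rewrite size_takel ?pg ?leq_addr.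
  by rewrite nth_take // -nth_pg.
have -> : drop k (permute s g) = arg_seq (fun i => nth 0 s (g (rshift k i))).
  apply: (arg_seqP (d := 0)) => [|i]; first by rewrite size_drop pg addKn.
  by rewrite nth_drop -nth_pg.
by rewrite !form_seqE smooth_fun_exprE.
Qed.

(** [form_of_seq] supplies a representing form, which rules out the default 0 of [form_of]. *)
Lemma form_ofE k (G : ('I_k -> sect A) -> smooth_fun M)
    (w : seq (sect A) -> smooth_fun M) x :
  is_form smul w -> (forall y, G y = w (arg_seq y)) ->
  form_eval (form_of G) x = G x.
Proof.
move=> fw Gw; have [z zE] := form_of_seq fw k.
rewrite /form_of; case: xgetP => [z' _ -> //|/(_ z)[]].
by move=> y; rewrite zE Gw.
Qed.

End FormsAsSeqForms.

Lemma sel_predC1 (T : Type) (i : nat) (s : seq T) :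
  sel (predC1 i) s = take i s ++ drop i.+1 s.
Proof.
elim: s i => [|x s IH] [|i] //; rewrite sel_cons /=; last by rewrite -IH.
by rewrite drop0 sel_predT.
Qed.

Lemma sel_lift (T : Type) k (i : 'I_k.+1) (x : 'I_k.+1 -> T) :
  sel (predC1 (i : nat)) (arg_seq x) = arg_seq (fun j => x (lift i j)).
Proof.
have sx := size_arg_seq x; have ik := ltnW (ltn_ord i).
rewrite sel_predC1; apply: (arg_seqP (d := x i)).
  by rewrite size_cat size_takel ?sx // size_drop sx subSS subnKC // -ltnS.
move=> j; rewrite nth_cat size_takel ?sx //.
case: (ltnP j i) => ji.
  rewrite nth_take // -(nth_arg_seq x (x i) (lift i j)) /= /bump.
  by rewrite leqNgt ji.
rewrite nth_drop -(nth_arg_seq x (x i) (lift i j)) /= /bump ji.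
by rewrite addSn subnKC.
Qed.

Lemma sel_arg_seq (T : Type) k (P : pred nat) (x : 'I_k -> T) :
  sel P (arg_seq x) = [seq x l | l : 'I_k <- enum 'I_k & P (val l)].
Proof.
rewrite /sel size_arg_seq filter_mask map_mask; congr mask.
by rewrite -val_enum_ord -map_comp.
Qed.

Lemma sf_cst_sign (R : realType) (n : nat) (M : manifold R n) k :
  sf_cst M ((-1) ^+ k) = (-1) ^+ k.
Proof. by apply: smooth_fun_eq => p; rewrite smooth_fun_exprE. Qed.

(** * Hom-Lie algebroids *)

Section Algebroid.
Variables (R : realType) (n : nat) (M : manifold R n) (r : nat).
Variable A : hom_lie_algebroid M r.
Variable psi : smooth_map M.
Hypotheses (mapK : cancel (hb_map A) psi) (psiK : cancel psi (hb_map A)).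
Hypothesis phi_bij : bijective (hb_phi A).
Implicit Types (x y z : sect A) (f g : smooth_fun M) (s : seq (sect A)).

Local Notation smul := (@sect_mul R n M r A).
Local Notation phi := (hb_phi A).
Local Notation tau := (hb_phi_inv A).
Local Notation sigma := (pullback (hb_map A)).
Local Notation sigma' := (pullback psi).

Lemma hb_phi_invK : cancel tau phi.
Proof.
move=> y; have [g gK phiK] := phi_bij.
by rewrite /hb_phi_inv; case: xgetP => [x _ //|/(_ (g y))[]]; exact: phiK.
Qed.

Lemma hb_phiK : cancel phi tau.
Proof. by move=> x; apply: (bij_inj phi_bij); rewrite hb_phi_invK. Qed.

(** Pullback is contravariant, so this order of composition uses [mapK]. *)
Lemma pullbackK : cancel sigma' sigma.
Proof. by move=> f; apply: smooth_fun_eq => p /=; rewrite mapK. Qed.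

Lemma pullbackK' : cancel sigma sigma'.
Proof. by move=> f; apply: smooth_fun_eq => p /=; rewrite psiK. Qed.

Lemma pullbackD (h : smooth_map M) : {morph pullback h : f g / f + g}.
Proof. by move=> f g; apply: smooth_fun_eq. Qed.

Lemma pullbackN (h : smooth_map M) : {morph pullback h : f / - f}.
Proof. by move=> f; apply: smooth_fun_eq. Qed.

Lemma pullbackM (h : smooth_map M) : {morph pullback h : f g / f * g}.
Proof. by move=> f g; apply: smooth_fun_eq. Qed.

Lemma hb_phiD : {morph phi : x y / x + y}.
Proof. by move=> x y; have := hb_phi_linear (h := A) 1 x y; rewrite !scale1r. Qed.

Lemma hb_phi_invD : {morph tau : x y / x + y}.
Proof.
by move=> x y; apply: (bij_inj phi_bij); rewrite hb_phiD !hb_phi_invK.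
Qed.

Lemma hb_phi_invZ f x : tau (smul f x) = smul (sigma' f) (tau x).
Proof.
by apply: (bij_inj phi_bij); rewrite hb_phi_mul pullbackK !hb_phi_invK.
Qed.

Definition twisted_bracket x y := tau (hla_bracket x y).

Definition twisted_act x f := sigma' (anchor_act (hla_anchor A) (phi x) f).

Lemma anchor_actDl x y f : anchor_act (hla_anchor A) (x + y) f =
  anchor_act (hla_anchor A) x f + anchor_act (hla_anchor A) y f.
Proof.
apply: smooth_fun_eq => p.
by rewrite -[LHS]/(hla_anchor A p (x p + y p) f) linearD.
Qed.

Lemma anchor_actZl x f g : anchor_act (hla_anchor A) (smul f x) g =
  f * anchor_act (hla_anchor A) x g.
Proof. by apply: smooth_fun_eq => p /=; rewrite linearZ. Qed.

Lemma anchor_actD x f g : anchor_act (hla_anchor A) x (f + g) =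
  anchor_act (hla_anchor A) x f + anchor_act (hla_anchor A) x g.
Proof.
apply: smooth_fun_eq => p /=.
by have := tval_linear (hla_anchor A p (x p)) 1 f g; rewrite scale1r mul1r.
Qed.

Lemma anchor_actM x f g : anchor_act (hla_anchor A) x (f * g) =
  anchor_act (hla_anchor A) x f * sigma g + sigma f * anchor_act (hla_anchor A) x g.
Proof. by apply: smooth_fun_eq => p /=; rewrite tval_leibniz. Qed.

Lemma bracketDr x y z :
  hla_bracket x (y + z) = hla_bracket x y + hla_bracket x z :> sect A.
Proof.
by have := bracket_linear_r (hla_hom_lie A) x 1 y z; rewrite !scale1r.
Qed.

Lemma hb_phi_inv_br : {morph tau : x y / hla_bracket x y}.
Proof.
move=> x y; apply: (bij_inj phi_bij).
by rewrite (hom_bracket (hla_hom_lie A)) !hb_phi_invK.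
Qed.

Lemma bracketxx x : hla_bracket x x = 0.
Proof.
have /eqP := bracket_skew (hla_hom_lie A) x x.
by rewrite -addr_eq0 -mulr2n -scaler_nat scaler_eq0 pnatr_eq0 /= => /eqP.
Qed.

(** Untwisting by [tau] and [sigma'] removes every [phi] and [sigma] from the Hom-axioms. *)
Lemma twisted_lie_rinehart : is_lie_rinehart smul twisted_bracket twisted_act.
Proof.
have skew := bracket_skew (hla_hom_lie A).
have tauN := morph_addN hb_phi_invD.
rewrite /twisted_bracket /twisted_act; split.
- by move=> x y z; rewrite bracketDr hb_phi_invD.
- by move=> x; rewrite bracketxx (morph_add0 hb_phi_invD).
- by move=> x y; rewrite skew tauN.
- move=> x y z; rewrite !hb_phi_inv_br.
  (* The triple is chosen so that [phi] of [tau (tau x)] is the [tau x] left after distributing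
     [tau] over the brackets. *)
  have := hom_jacobi (hla_hom_lie A) (tau (tau x)) (tau (tau y)) (tau (tau z)).
  rewrite !hb_phi_invK (skew _ (tau z)) (skew (tau (tau x)) (tau (tau z))).
  have bN u : {morph hla_bracket u : v / - v} := morph_addN (bracketDr u).
  by rewrite bN => /eqP; rewrite -addrA addr_eq0 opprD addrC => /eqP.
- move=> x f y; rewrite hla_leibniz hb_phi_invD !hb_phi_invZ.
  by rewrite pullbackK' hb_phiK.
- by move=> x f g; rewrite anchor_actD pullbackD.
- by move=> x f g; rewrite anchor_actM pullbackD !pullbackM !pullbackK'.
- by move=> x y f; rewrite hb_phiD anchor_actDl pullbackD.
- by move=> f x g; rewrite hb_phi_mul anchor_actZl pullbackM pullbackK'.
- move=> x y f; rewrite hb_phi_invK.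
  (* Compatibility of the anchor with [sigma] lets [sigma'] move inside the action, as [rep_bracket]
     requires. *)
  have actE z : sigma' (anchor_act (hla_anchor A) (phi z) f) =
      anchor_act (hla_anchor A) z (sigma' f).
    by rewrite -{1}(pullbackK f) (rep_hom (hla_rep A)) pullbackK'.
  rewrite !actE -{1}(pullbackK f) (rep_bracket (hla_rep A)).
  by rewrite pullbackD pullbackN.
Qed.

Lemma twisted_act_sigma x f : twisted_act x (sigma f) = sigma (twisted_act (tau x) f).
Proof.
rewrite /twisted_act pullbackK hb_phi_invK (rep_hom (hla_rep A)).
exact: pullbackK'.
Qed.

Lemma twisted_bracket_inv : {morph tau : x y / twisted_bracket x y}.
Proof. by move=> x y; rewrite /twisted_bracket -!hb_phi_inv_br. Qed.

Local Notation twist := (twist sigma tau).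
Local Notation d := (cediff twisted_bracket twisted_act).

Lemma is_form_twist_A w : is_form smul w -> is_form smul (twist w).
Proof.
apply: is_form_twist; [exact: pullbackD|exact: pullbackM|exact: pullbackK| |].
  exact: hb_phi_invD.
exact: hb_phi_invZ.
Qed.

Lemma dagger_rhsE k (w : bform A k) (x : 'I_k -> sect A) :
  dagger_rhs w x = twist (form_seq w) (arg_seq x).
Proof. by rewrite /twist map_arg_seq form_seqE. Qed.

Lemma form_eval_dagger k (w : bform A k) (x : 'I_k -> sect A) :
  form_eval (dagger w) x = dagger_rhs w x.
Proof.
apply: form_ofE (dagger_rhsE w).
exact/is_form_twist_A/is_form_form_seq.
Qed.

Lemma form_seq_dagger k (w : bform A k) : form_seq (dagger w) = twist (form_seq w).
Proof.
apply: funext => s; have [sk|sk] := eqVneq (size s) k; last first.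
  rewrite form_seq_degree // /twist form_seq_degree ?size_map //.
  by apply: smooth_fun_eq.
rewrite (arg_seqP (d := 0) (x := fun i : 'I_k => nth 0 s i) sk) //.
by rewrite form_seqE form_eval_dagger dagger_rhsE.
Qed.

Lemma pullback_sum (I : Type) (u : seq I) (P : pred I) (F : I -> smooth_fun M) :
  sigma (\sum_(i <- u | P i) F i) = \sum_(i <- u | P i) sigma (F i).
Proof.
by apply: (big_morph _ (pullbackD _)); apply: smooth_fun_eq.
Qed.

Lemma sign_scaleE i f : (-1 : R) ^+ i *: f = (-1) ^+ i * f.
Proof.
rewrite -[in LHS]signr_odd -[in RHS]signr_odd.
by case: odd; rewrite ?expr1 ?scale1r ?mul1r // scaleN1r mulN1r.
Qed.

Lemma pullback_sign i f : sigma ((-1) ^+ i * f) = (-1) ^+ i * sigma f.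
Proof.
by rewrite -signr_odd; case: odd; rewrite /= ?expr0 ?expr1 ?mul1r // !mulN1r pullbackN.
Qed.

(** The factorisation of the differential: [sigma] cancels the [sigma'] of [twisted_act], and the
    [tau] of [twisted_bracket] is the one by which [dagger] acts on the bracket argument. *)
Lemma hom_diff_rhsE k (w : bform A k) (x : 'I_k.+1 -> sect A) :
  hom_diff_rhs w x = twist (d (form_seq w)) (arg_seq x).
Proof.
rewrite /twist (cediffE _ _ _ (smul := smul)); last exact: is_form_form_seq.
rewrite map_arg_seq size_arg_seq pullbackD !pullback_sum; congr (_ + _).
  apply: eq_bigr => i _; rewrite pullback_sign nth_arg_seq -sign_scaleE.
  rewrite /twisted_act pullbackK hb_phi_invK; congr (_ *: anchor_act _ _ _).
  by rewrite sel_lift form_seqE.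
apply: eq_bigr => i _; rewrite pullback_sum; apply: eq_bigr => j ij.
rewrite pullback_sign -sign_scaleE; congr (_ *: _).
rewrite form_eval_dagger dagger_rhsE /twist; congr (sigma (form_seq w _)).
rewrite !nth_arg_seq sel_arg_seq .
have -> : arg_seq (bracket_args x i j) = hla_bracket (tau (x i)) (tau (x j)) ::
    [seq x l | l : 'I_k.+1 <- enum 'I_k.+1 & (l != i) && (l != j)].
  (* Omitting two distinct indices of [k.+1] and adding the bracket leaves exactly [k] entries, so
     the default of [nth] in [bracket_args] is never read. *)
  symmetry; apply: (arg_seqP (d := 0)) => [|//] /=.
  have ij' : i != j by rewrite neq_ltn ij.
  have c2 : count (pred2 i j) (enum 'I_k.+1) = 2.
    transitivity #|pred2 i j|; last by rewrite card2 ij'.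
    by rewrite enumT cardE /enum_mem size_filter; apply: eq_count.
  have := count_predC (pred2 i j) (enum 'I_k.+1).
  rewrite size_map size_filter c2 size_enum_ord => -[ck].
  by rewrite -[RHS]ck; congr _.+1; apply: eq_count => l; rewrite /= negb_or.
by rewrite /= -map_comp.
Qed.

Lemma form_eval_hom_diff k (w : bform A k) (x : 'I_k.+1 -> sect A) :
  form_eval (hom_diff w) x = hom_diff_rhs w x.
Proof.
apply: form_ofE (hom_diff_rhsE w).
apply: is_form_twist_A; apply: (is_form_cediff twisted_lie_rinehart).
exact: is_form_form_seq.
Qed.

Lemma form_seq_hom_diff k (w : bform A k) :
  form_seq (hom_diff w) = twist (d (form_seq w)).
Proof.
apply: funext => s; have [sk|sk] := eqVneq (size s) k.+1; last first.
  rewrite form_seq_degree // /twist (has_degree_cediff twisted_lie_rinehart (form_seq_degree w)) ?size_map //.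
  by apply: smooth_fun_eq.
rewrite (arg_seqP (d := 0) (x := fun i : 'I_k.+1 => nth 0 s i) sk) //.
by rewrite form_seqE form_eval_hom_diff hom_diff_rhsE.
Qed.

Lemma twist_shuffle_A u v : twist (shuffle u v) = shuffle (twist u) (twist v).
Proof. by apply: twist_shuffle; [exact: pullbackD|exact: pullbackM]. Qed.

Lemma cediff_twist_A w : d (twist w) = twist (d w).
Proof.
apply: cediff_twist; [exact: pullbackD|exact: twisted_bracket_inv|].
exact: twisted_act_sigma.
Qed.

(** Both twists move outside, leaving the square of the Chevalley-Eilenberg differential. *)
Lemma hom_diffK k (w : bform A k) : hom_diff (hom_diff w) = 0.
Proof.
apply: form_seq_inj; rewrite !form_seq_hom_diff form_seq0 cediff_twist_A.
rewrite (cediff_cediff twisted_lie_rinehart (is_form_form_seq w)).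
by apply: funext => s; apply: smooth_fun_eq.
Qed.

Lemma hom_diff_dagger k (w : bform A k) : hom_diff (dagger w) = dagger (hom_diff w).
Proof.
apply: form_seq_inj.
by rewrite form_seq_hom_diff !form_seq_dagger form_seq_hom_diff cediff_twist_A.
Qed.

(** The twist, being multiplicative, is applied to the ordinary Leibniz rule [cediff_shuffle]; it
    puts [dagger] on the undifferentiated factors. *)
Lemma hom_diff_wedge k l (w : bform A k) (z : bform A l) :
  hom_diff (wedge w z) = (wedge (hom_diff w) (dagger z) : bform A (k + l).+1) +
    (-1) ^+ k *: gcast (C := bform A) (addnS k l) (wedge (dagger w) (hom_diff z)).
Proof.
apply: form_seq_inj; rewrite form_seq_hom_diff form_seqD form_seqZ form_seq_gcast.
rewrite [form_seq (wedge (hom_diff w) _)](form_seq_wedge (hom_diff w) (dagger z)).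
rewrite !form_seq_wedge !form_seq_dagger !form_seq_hom_diff.
rewrite (cediff_shuffle twisted_lie_rinehart).
rewrite (has_parityE (has_degree_parity (form_seq_degree w))) shuffleZl signr_odd.
rewrite -!twist_shuffle_A sf_cst_sign; apply: funext => s; rewrite !fctE.
by rewrite /twist pullbackD /scale_form pullback_sign.
Qed.

Lemma dagger_linear k : linear (@dagger R n M r A k).
Proof.
move=> a w z; apply: form_seq_inj; rewrite form_seqD form_seqZ !form_seq_dagger.
by rewrite form_seqD form_seqZ; apply: funext => s; apply: smooth_fun_eq.
Qed.

Lemma dagger_one : dagger (form_one A) = form_one A.
Proof.
apply: form_seq_inj; rewrite form_seq_dagger form_seq_one.
by apply: funext => -[|x s]; apply: smooth_fun_eq.
Qed.

Lemma dagger_wedge k l (w : bform A k) (z : bform A l) :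
  dagger (wedge w z) = wedge (dagger w) (dagger z).
Proof.
apply: form_seq_inj; rewrite form_seq_dagger !form_seq_wedge !form_seq_dagger.
exact: twist_shuffle_A.
Qed.

(** A derivation kills 1, since [v 1 = v 1 + v 1]. This makes [d] linear over the reals. *)
Lemma twisted_act_cst x (a : R) : twisted_act x (sf_cst M a) = 0.
Proof.
apply: smooth_fun_eq => p; set v := hla_anchor A (psi p) (phi x (psi p)).
have v1 : v 1 = 0.
  have := tval_leibniz v 1 1; rewrite mulr1 /= mulr1 mul1r => /eqP.
  by rewrite -subr_eq subrr => /eqP.
have v0 : v 0 = 0.
  by have := tval_linear v (-1) 1 1; rewrite scaleN1r addNr v1 mulr0 addr0.
transitivity (v (a *: (1 : smooth_fun M) + 0)); last by rewrite tval_linear v1 v0 mulr0 addr0.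
rewrite -[LHS]/(v (sf_cst M a)) addr0; congr (v _).
by apply: smooth_fun_eq => q /=; rewrite mulr1.
Qed.

Lemma hom_diff_linear k : linear (@hom_diff R n M r A k).
Proof.
move=> a w z; apply: form_seq_inj; rewrite form_seqD form_seqZ !form_seq_hom_diff.
rewrite form_seqD form_seqZ (cediffD twisted_lie_rinehart) (cediffZ twisted_lie_rinehart).
have -> : d (zero_form (sf_cst M a)) = 0.
  apply: funext => -[//|x s].
  have /(congr1 (@^~ s)) := cediff_zero_form twisted_lie_rinehart (sf_cst M a) x.
  by rewrite /contract => ->; rewrite twisted_act_cst; case: s.
by rewrite shuffle0l addr0; apply: funext => s; apply: smooth_fun_eq.
Qed.

End Algebroid.

(** * The graded commutative algebra of forms *)

Section WedgeAlgebra.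
Variables (R : realType) (n : nat) (M : manifold R n) (r : nat).
Variable A : vbundle M r.

Lemma wedge_graded_comm_algebra :
  is_graded_comm_algebra (C := bform A) (form_one A) (@wedge R n M r A).
Proof.
split.
- move=> k l z a w w'; apply: form_seq_inj.
  by rewrite form_seqD form_seqZ !form_seq_wedge form_seqD form_seqZ shuffleDl shuffleZl.
- move=> k l w a z z'; apply: form_seq_inj.
  by rewrite form_seqD form_seqZ !form_seq_wedge form_seqD form_seqZ shuffleDr shuffleZr.
- move=> k l m a b c; apply: form_seq_inj.
  by rewrite form_seq_gcast !form_seq_wedge shuffleA.
- move=> k a; apply: form_seq_inj.
  by rewrite form_seq_wedge form_seq_one shuffle_zero_form scale_form1.
- move=> k a; apply: form_seq_inj.
  rewrite form_seq_gcast form_seq_wedge form_seq_one.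
  rewrite (shuffleC (has_degree_parity (form_seq_degree a)) (@zero_form_parity _ _ 1)).
  by rewrite andbF shuffle_zero_form !scale_form1.
- move=> k l a b; apply: form_seq_inj.
  rewrite form_seqZ form_seq_gcast !form_seq_wedge.
  rewrite (shuffleC (has_degree_parity (form_seq_degree a)) (has_degree_parity (form_seq_degree b))).
  by rewrite -oddM signr_odd sf_cst_sign.
Qed.

End WedgeAlgebra.

(** Since [dagger] and [hom_diff] come from [form_of], which has a default value, the first two
    conjuncts certify that they satisfy their defining formulas. *)
Theorem theorem3p7 (R : realType) (n : nat) (M : manifold R n) (r : nat)
    (A : hom_lie_algebroid M r) (hA : hb_invertible A) :
  (* the defining formulas of phi_A^dagger and d *)
  (forall k (Xi : bform A k) (x : 'I_k -> sect A),
      form_eval (dagger Xi) x = dagger_rhs Xi x) /\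
  (forall k (Xi : bform A k) (x : 'I_k.+1 -> sect A),
      form_eval (hom_diff Xi) x = hom_diff_rhs Xi x) /\
  (forall k (Xi : bform A k), hom_diff (hom_diff Xi) = 0) /\
  (forall k (Xi : bform A k), hom_diff (dagger Xi) = dagger (hom_diff Xi)) /\
  (forall k l (Xi : bform A k) (Theta : bform A l),
      hom_diff (wedge Xi Theta) =
        (wedge (hom_diff Xi) (dagger Theta) : bform A (k + l).+1) +
        (-1) ^+ k *: gcast (C := bform A) (addnS k l)
                       (wedge (dagger Xi) (hom_diff Theta))) /\
  is_dgca (C := bform A) (form_one A) (@wedge R n M r A)
    (@dagger R n M r A) (@dagger R n M r A) (@hom_diff R n M r A).
Proof.
have [[psi [mapK psiK]] phi_bij] := hA.
have dagger_endo : is_graded_endo (C := bform A) (form_one A) (@wedge R n M r A)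
    (@dagger R n M r A).
  split; [exact: dagger_linear mapK phi_bij|exact: dagger_one mapK phi_bij|].
  exact: dagger_wedge mapK phi_bij.
have dd := hom_diffK mapK psiK phi_bij.
have d_dagger := hom_diff_dagger mapK psiK phi_bij.
have d_wedge := hom_diff_wedge mapK psiK phi_bij.
do 5![split; first by [|exact: form_eval_dagger mapK phi_bij|
  exact: form_eval_hom_diff mapK psiK phi_bij]].
split=> //; first exact: wedge_graded_comm_algebra.
exact: hom_diff_linear mapK psiK phi_bij.
Qed.
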